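(* Let $\mu\in\mathcal{P}(\mathbb{R}^d)$ and let $\underline{r}=(r_k)_{k=1}^\infty$ be a sequence of positive numbers tending to $0$. If $s_2(\underline{r})<\overline{\dim}_{\mathrm{H}}\,\mu$, then $$s_2(\underline{r})\,\overline{\delta}\le f_{\mu}(\underline{r})\le s_2(\underline{r}),$$ where $$\overline{\delta}:=\operatorname*{ess\,sup}_{\substack{x\sim\mu,\\ \underline{\dim}_{\mathrm{loc}}\,\mu(x)>s_2(\underline{r})}}\frac{\underline{\dim}_{\mathrm{loc}}\,\mu(x)}{\overline{\dim}_{\mathrm{loc}}\,\mu(x)}$$ is the $\mu$-essential supremum of the ratio over the set of points $x$ with $\underline{\dim}_{\mathrm{loc}}\,\mu(x)>s_2(\underline{r})$.
   Context: $\mathcal{P}(\mathbb{R}^d)$ is the set of compactly supported Borel probability measures on $\mathbb{R}^d$; $\operatorname{spt}\mu$ is the support of $\mu$; $B(x,r)$ is the open ball with centre $x$ and radius $r$; $\dim_{\mathrm{H}}$ of a set is its Hausdorff dimension. Local dimensions: $\underline{\dim}_{\mathrm{loc}}\,\mu(x):=\liminf_{r\to 0}\frac{\log\mu(B(x,r))}{\log r}$ and $\overline{\dim}_{\mathrm{loc}}\,\mu(x):=\limsup_{r\to 0}\frac{\log\mu(B(x,r))}{\log r}$. Upper Hausdorff dimension of $\mu$: $\overline{\dim}_{\mathrm{H}}\,\mu:=\operatorname{ess\,sup}_{x\sim\mu}\underline{\dim}_{\mathrm{loc}}\,\mu(x)$. For a sequence $\underline{r}=(r_k)_{k=1}^\infty$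 of positive numbers, $s_2(\underline{r}):=\inf\{s>0\mid\sum_{k=1}^\infty r_k^s<\infty\}$. Random covering sets: let $\Omega:=(\operatorname{spt}\mu)^{\mathbb{N}}$ with the product probability measure $\mathbb{P}:=\mu^{\mathbb{N}}$. For $\omega=(\omega_k)_{k\ge1}\in\Omega$ put $E_{\underline{r}}(\omega):=\limsup_{k\to\infty}B(\omega_k,r_k)=\bigcap_{k=1}^\infty\bigcup_{n=k}^\infty B(\omega_n,r_n)$. By Kolmogorov's zero-one law, $\dim_{\mathrm{H}}E_{\underline{r}}(\omega)$ is constant for $\mathbb{P}$-almost every $\omega$, and $f_\mu(\underline{r})$ denotes this almost sure value. *)

(* Defs.v *)
From HB Require Import structures.
From mathcomp Require Import all_boot all_order all_algebra.
From mathcomp Require Import all_classical all_reals all_analysis.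
From mathcomp Require Import ess_sup_inf.
Import Order.TTheory GRing.Theory Num.Theory.
Import numFieldTopology.Exports numFieldNormedType.Exports.

Set Implicit Arguments.
Unset Strict Implicit.
Unset Printing Implicit Defensive.

Local Open Scope classical_set_scope.
Local Open Scope ring_scope.

(* R^d with its Borel sigma-algebra. *)
Definition borelRd (R : realType) (d : nat) :=
  g_sigma_algebraType (@open 'rV[R]_d).

Section euclidean.
Variables (R : realType) (d : nat).
Implicit Types (x y : 'rV[R]_d) (A : set 'rV[R]_d).

(* The library's norm and balls on row vectors are those of the sup norm. *)
Definition enorm x : R := Num.sqrt (\sum_(i < d) x ord0 i ^+ 2).

Definition eball x (e : R) : set 'rV[R]_d := [set y | enorm (y - x) < e].

(* diam set0 = -oo *)
Definition diam A : \bar R :=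
  ereal_sup [set z | exists x y, [/\ A x, A y & z = (enorm (x - y))%:E]].

End euclidean.

Section hausdorff_dimension.
Variables (R : realType) (d : nat).
Implicit Types (A U : set 'rV[R]_d) (s delta : R).
Local Open Scope ereal_scope.

(* diam(U)^s, with 0^0 = 1 for nonempty U, and with value 0 for empty U. *)
Definition diam_pow s U : \bar R :=
  if `[< U = set0 >] then 0 else diam U `^ s.

Definition hausdorff_premeasure s delta A : \bar R :=
  ereal_inf [set \sum_(0 <= i <oo) diam_pow s (U i) |
    U in [set U : nat -> set 'rV[R]_d |
      A `<=` \bigcup_i U i /\ forall i, diam (U i) <= delta%:E]].

Definition hausdorff_measure s A : \bar R :=
  ereal_sup [set hausdorff_premeasure s delta A | delta in [set t | (0 < t)%R]].

Definition hausdorff_dim A : \bar R :=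
  ereal_inf [set s%:E | s in [set s | (0 <= s)%R /\ hausdorff_measure s A = 0]].

End hausdorff_dimension.

Section dimensions_of_measures.
Variables (R : realType) (d : nat) (mu : probability (borelRd R d) R).
Local Open Scope ereal_scope.

Definition spt : set 'rV[R]_d :=
  [set x | forall e : R, (0 < e)%R -> 0 < mu (eball x e)].

(* lne 0 = -oo, so the quotient is +oo when mu (eball x t) = 0 and 0 < t < 1. *)
Definition log_ratio (x : 'rV[R]_d) (t : R) : \bar R :=
  lne (mu (eball x t)) / (ln t)%:E.

Definition lower_dim_loc (x : 'rV[R]_d) : \bar R :=
  limf_einf (log_ratio x) (0%R : R)^'+.

Definition upper_dim_loc (x : 'rV[R]_d) : \bar R :=
  limf_esup (log_ratio x) (0%R : R)^'+.

Definition upper_dim_H : \bar R := ess_sup mu lower_dim_loc.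

(* The value -oo off A makes this the essential supremum of f over A. *)
Definition ess_sup_on (A : set (borelRd R d)) (f : borelRd R d -> \bar R) :
    \bar R :=
  ess_sup mu (fun x => if `[< A x >] then f x else -oo).

Definition dim_loc_ratio (s : \bar R) : \bar R :=
  ess_sup_on [set x | s < lower_dim_loc x]
             (fun x => lower_dim_loc x / upper_dim_loc x).

End dimensions_of_measures.

Definition s2 (R : realType) (r : nat -> R) : \bar R :=
  ereal_inf [set s%:E | s in [set s : R |
    0 < s /\ (\sum_(0 <= k <oo) (r k `^ s)%:E < +oo)%E]].

(* Sequences in R^d, with the product sigma-algebra. *)
Definition coord_sets (R : realType) (d : nat) : set (set (nat -> 'rV[R]_d)) :=
  [set C | exists k (A : set (borelRd R d)),
    measurable A /\ C = [set w | A (w k)]].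

Definition seqRd (R : realType) (d : nat) :=
  g_sigma_algebraType (@coord_sets R d).

Section random_covering.
Variables (R : realType) (d : nat).
Implicit Types (mu : probability (borelRd R d) R) (r : nat -> R)
  (P : probability (seqRd R d) R).

(* P = mu^N: the values on finite-dimensional boxes determine P. *)
Definition is_product_measure mu P : Prop :=
  forall (n : nat) (A : nat -> set (borelRd R d)),
    (forall k, measurable (A k)) ->
    P [set w | forall k, (k < n)%N -> A k (w k)] =
    (\prod_(k < n) mu (A k))%E.

Definition covering_set r (w : nat -> 'rV[R]_d) : set 'rV[R]_d :=
  lim_sup_set (fun k => eball (w k) (r k)).

(* f is the almost sure value of the dimension on Omega = (spt mu)^N, which is
   a subset of full P-measure of the space of all sequences. *)
Definition is_as_dim mu P r (f : \bar R) : Prop :=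
  \forall w \ae P, (forall k, spt mu (w k)) ->
    hausdorff_dim (covering_set r w) = f.

End random_covering.

(* Main.v *)
(* The upper bound covers the limsup set by the balls of index at least N.

   For the lower bound, let s < s_2(r), so that the series of the r_k^s diverges.
   An Egorov-type argument gives a compact set F of positive measure and exponents
   s_2(r) < a < b, with a / b close to the essential supremum, such that
   c e^b <= mu(B(x, e)) <= C e^a on F. Put rho_k = r_k / 2. On a block of indices
   consider the random density
     D(x) = sum_k c_k 1[w_k in B(x, rho_k)] / mu(B(x, rho_k)),
   where c_k is proportional to rho_k^s and the c_k add up to 1. Its expectation is 1
   on F, and it vanishes outside the balls B(w_k, rho_k). The product Z of the densities
   of n successive blocks has mean mass mu(F). By independence its mean t-energy stays
   bounded for every t < s a / b, provided that each block carries a large enough part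
   of the divergent series: the diagonal terms of a block contribute at most the inverse
   of the sum of its rho_k^s. This uses the interpolation min(u, v) <= u^(1-q) v^q with
   q = s / b between the bounds O(1) and O(rho_k^(-b) e^a) for the measure of the pairs
   at distance at most e. Hence with positive probability Z mu has, for infinitely many
   n, mass bounded below and energy bounded above. Compactness then bounds the
   t-dimensional Hausdorff sums of all covers of the limsup set from below, without
   constructing a limit measure. *)
Require Import Defs.
From HB Require Import structures.
From mathcomp Require Import all_boot all_order all_algebra.
From mathcomp Require Import all_classical all_reals all_analysis.
From mathcomp Require Import ess_sup_inf measurable_realfun.
From mathcomp Require Import ring lra.
Import Order.TTheory GRing.Theory Num.Theory.
Import numFieldTopology.Exports numFieldNormedType.Exports.
Local Open Scope classical_set_scope.
Local Open Scope ring_scope.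
Set Implicit Arguments.
Unset Strict Implicit.
Unset Printing Implicit Defensive.

(** * The Euclidean norm and Borel sets *)

Section euclidean_norm.
Context {R : realType} {d : nat}.
Implicit Types x y z : 'rV[R]_d.

Lemma enorm_ge0 x : 0 <= enorm x.
Proof. exact: sqrtr_ge0. Qed.

Lemma enorm_sqr x : enorm x ^+ 2 = \sum_(i < d) x ord0 i ^+ 2.
Proof. by rewrite sqr_sqrtr// sumr_ge0// => i _; exact: sqr_ge0. Qed.

Lemma enorm0 : enorm (0 : 'rV[R]_d) = 0.
Proof.
rewrite /enorm big1 ?sqrtr0// => i _.
by rewrite mxE expr0n.
Qed.

Lemma enormN x : enorm (- x) = enorm x.
Proof. by rewrite /enorm; congr Num.sqrt; apply: eq_bigr => i _; rewrite mxE sqrrN. Qed.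

Lemma enormB x y : enorm (x - y) = enorm (y - x).
Proof. by rewrite -enormN opprB. Qed.

(** Cauchy-Schwarz from the identity [A * (A * B - C ^+ 2) = \sum_i (A y_i - C x_i)^2], where [A]
    and [B] are the squared norms and [C] is the scalar product. *)
Lemma dot_le_enorm x y :
  \sum_(i < d) x ord0 i * y ord0 i <= enorm x * enorm y.
Proof.
set C := \sum_(i < d) _.
have [x0|x0] := eqVneq (enorm x) 0.
  rewrite x0 mul0r /C big1// => i _.
  have : \sum_(i < d) x ord0 i ^+ 2 = 0 by rewrite -enorm_sqr x0 expr0n.
  move/eqP; rewrite psumr_eq0 => [/allP/(_ i)|j _]; last exact: sqr_ge0.
  by rewrite mem_index_enum => /(_ isT)/=; rewrite sqrf_eq0 => /eqP ->; rewrite mul0r.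
apply: ler_normlW; rewrite -(@ler_pXn2r _ 2)// ?nnegrE ?mulr_ge0 ?enorm_ge0//.
rewrite real_normK ?num_real// exprMn.
have A0 : 0 < enorm x ^+ 2 by rewrite exprn_gt0// lt_neqAle eq_sym x0 enorm_ge0.
rewrite -subr_ge0 -(pmulr_rge0 _ A0).
set A := enorm x ^+ 2; set B := enorm y ^+ 2.
suff -> : A * (A * B - C ^+ 2) = \sum_(i < d) (A * y ord0 i - C * x ord0 i) ^+ 2.
  by rewrite sumr_ge0// => i _; exact: sqr_ge0.
transitivity (\sum_(i < d) (A ^+ 2 * y ord0 i ^+ 2 - (2 * A * C) * (x ord0 i * y ord0 i)
                            + C ^+ 2 * x ord0 i ^+ 2)); last first.
  by apply: eq_bigr => i _; ring.
rewrite big_split sumrB/= -!mulr_sumr -!enorm_sqr -/A -/B -/C.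
by ring.
Qed.

Lemma enormD x y : enorm (x + y) <= enorm x + enorm y.
Proof.
rewrite -(@ler_pXn2r _ 2)// ?nnegrE ?addr_ge0 ?enorm_ge0//.
rewrite sqrrD !enorm_sqr.
rewrite (eq_bigr (fun i => x ord0 i ^+ 2 + (x ord0 i * y ord0 i) *+ 2 + y ord0 i ^+ 2)); last first.
  by move=> i _; rewrite mxE sqrrD.
rewrite !big_split/= lerD2r lerD2l -mulr2n lerMn2r/=.
exact: dot_le_enorm.
Qed.

Lemma enorm_triangle x y z : enorm (x - z) <= enorm (x - y) + enorm (y - z).
Proof. by rewrite (le_trans _ (enormD _ _))// addrA subrK. Qed.

Lemma continuous_enorm : continuous (@enorm R d).
Proof.
move=> x; apply: (@continuous_comp _ _ _ _ Num.sqrt); last exact: sqrt_continuous.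
suff : continuous (fun y : 'rV[R]_d => \sum_(i < d) y ord0 i ^+ 2) by exact.
apply: continuous_big => [|i _ y]; first exact: add_continuous.
by apply: (@continuous_comp _ _ _ (fun y : 'rV[R]_d => y ord0 i) (fun r => r ^+ 2));
  [exact: coord_continuous | exact: exprn_continuous].
Qed.

Lemma continuous_enormB x : continuous (fun y => enorm (y - x)).
Proof.
move=> y; apply: (@continuous_comp _ _ _ (fun y => y - x) (@enorm R d));
  last exact: continuous_enorm.
by apply: continuousB; [exact: cvg_id|exact: cst_continuous].
Qed.

Lemma open_eball x (e : R) : open (eball x e).
Proof.
rewrite (_ : eball x e = (fun y => enorm (y - x)) @^-1` [set u | u < e]) //.
apply: open_comp; last exact: open_lt.
by move=> y _; exact: continuous_enormB.
Qed.

Lemma closed_enormB_le x (e : R) : closed [set y | enorm (y - x) <= e].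
Proof.
rewrite (_ : [set _ | _] = (fun y => enorm (y - x)) @^-1` [set u | u <= e]) //.
apply: preimage_closed; last exact: closed_le.
by move=> y _; exact: continuous_enormB.
Qed.

Lemma eball_center x (e : R) : 0 < e -> eball x e x.
Proof. by move=> e0; rewrite /eball/= subrr enorm0. Qed.

Lemma eball_sym x y (e : R) : eball x e y = eball y e x.
Proof. by rewrite /eball/= enormB. Qed.

Lemma sub_eball x y (e e' : R) : enorm (y - x) + e <= e' -> eball y e `<=` eball x e'.
Proof.
move=> h z; rewrite /eball/= => zy.
have := enorm_triangle z y x; lra.
Qed.

Lemma eball_half x y z (e : R) : eball x (e / 2) y -> eball x (e / 2) z -> eball y e z.
Proof. by rewrite /eball/= => xy xz; have := enorm_triangle z x y; rewrite (enormB x y); lra. Qed.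

End euclidean_norm.

Section borel_measurability.
Context {R : realType} {d : nat}.
Local Notation T := (borelRd R d).

Lemma open_measurableRd (A : set 'rV[R]_d) : open A -> measurable (A : set T).
Proof. by move=> oA; exact: sub_sigma_algebra. Qed.

Lemma closed_measurableRd (A : set 'rV[R]_d) : closed A -> measurable (A : set T).
Proof.
by move=> cA; rewrite -(setCK A); apply: measurableC; apply: open_measurableRd; exact: closed_openC.
Qed.

Lemma measurable_eball x (e : R) : measurable (eball x e : set T).
Proof. by apply: open_measurableRd; exact: open_eball. Qed.

Lemma continuous_measurableRd (f : 'rV[R]_d -> R) : continuous f ->
  measurable_fun [set: T] (f : T -> R).
Proof.
move=> cf; apply: (measurability _ (RGenOpens.measurableE R)) => _ [_ [a [b ->]] <-].
rewrite setTI; apply: open_measurableRd; apply: open_comp => // x _; exact: cf.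
Qed.

Lemma measurable_coordRd (i : 'I_d) : measurable_fun [set: T] (fun x : T => x ord0 i).
Proof. by apply: continuous_measurableRd; exact: coord_continuous. Qed.

Lemma measurable_enormB d' (S : measurableType d') (f g : S -> T) :
  measurable_fun setT f -> measurable_fun setT g ->
  measurable_fun setT (fun s => enorm (f s - g s : 'rV[R]_d)).
Proof.
move=> mf mg; rewrite /enorm.
apply: measurableT_comp.
  by apply: continuous_measurable_fun; exact: sqrt_continuous.
rewrite (_ : (fun _ => _) =
  (fun s => \sum_(i < d) (f s ord0 i - g s ord0 i) ^+ 2)); last first.
  by apply/funext => s; apply: eq_bigr => i _; rewrite !mxE.
apply: measurable_sum => i; apply: measurable_funX.
by apply: measurable_funB; apply: (measurableT_comp (measurable_coordRd i)).
Qed.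

Lemma measurable_near d' (S : measurableType d') (f g : S -> T) (e : R) :
  measurable_fun setT f -> measurable_fun setT g ->
  measurable [set s | eball (f s) e (g s)].
Proof.
move=> mf mg; have := measurable_enormB mg mf => /(_ measurableT [set u | u < e]).
by rewrite setTI; apply; apply: open_measurable; exact: open_lt.
Qed.

End borel_measurability.

(** * Measures of balls *)

(** The [q i] form a grid of mesh 1/M in [-1, 1)^d with M = 2(d+1). Rounding (y - x)/e down to this
    grid moves it by at most sqrt(d)/M < 1/2. One finite family serves all centres and radii, so the
    number of balls depends on [d] only. *)
Lemma eball_half_cover (R : realType) (d : nat) :
  exists (I : finType) (q : I -> 'rV[R]_d), forall (x : 'rV[R]_d) (e : R), 0 < e ->
    forall y, eball x e y -> exists i, eball (x + e *: q i) (e / 2) y.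
Proof.
pose M := (2 * d.+1)%N.
have M0 : 0 < M%:R :> R by rewrite ltr0n.
exists {ffun 'I_d -> 'I_(2 * M)}, (fun c : {ffun 'I_d -> 'I_(2 * M)} =>
  \row_i ((c i)%:R / M%:R - 1)) => x e e0 y xy.
pose u i := (y ord0 i - x ord0 i) / e.
have u1 i : `|u i| < 1.
  rewrite /u normrM normfV (gtr0_norm e0) ltr_pdivrMr// mul1r.
  rewrite (le_lt_trans _ xy)// -(@ler_pXn2r _ 2)// ?nnegrE ?enorm_ge0//.
  rewrite real_normK ?num_real// enorm_sqr (bigD1 i)//= !mxE lerDl.
  by rewrite sumr_ge0// => j _; exact: sqr_ge0.
pose v i := (u i + 1) * M%:R.
have v0 i : 0 <= v i.
  by rewrite mulr_ge0// ?(ltW M0)//; move: (u1 i); rewrite ltr_norml => /andP[]; lra.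
have vM i : (Num.truncn (v i) < 2 * M)%N.
  rewrite truncn_lt_nat// natrM /v ltr_pM2r//.
  by move: (u1 i); rewrite ltr_norml => /andP[]; lra.
exists [ffun i => Ordinal (vM i)].
rewrite /eball/= -(@ltr_pXn2r _ 2)// ?nnegrE ?enorm_ge0 ?divr_ge0 ?ltW//.
rewrite enorm_sqr.
apply: (@le_lt_trans _ _ (\sum_(i < d) (e / M%:R) ^+ 2)).
  apply: ler_sum => i _; rewrite !mxE ffunE/=.
  have /andP[k1 k2] := truncn_itv (v0 i).
  have -> : y ord0 i - (x ord0 i + e * ((Num.truncn (v i))%:R / M%:R - 1)) =
      (e / M%:R) * (v i - (Num.truncn (v i))%:R).
    by rewrite /v /u; field; rewrite !gt_eqF.
  rewrite exprMn ger_pMr; last by rewrite exprn_gt0// divr_gt0.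
  rewrite expr_le1// ?subr_ge0//.
  by move: k2; rewrite -natr1; lra.
rewrite sumr_const card_ord -[ltLHS]mulr_natr.
have D0 : 0 <= d%:R :> R by exact: ler0n.
rewrite (_ : (e / M%:R) ^+ 2 * d%:R = (e / 2) ^+ 2 * (d%:R / (d%:R + 1) ^+ 2)); last first.
  have -> : M%:R = 2 * (d%:R + 1) :> R by rewrite /M natrM -[d.+1%:R]natr1.
  by field; rewrite gt_eqF// ltr_wpDl.
by rewrite gtr_pMr ?exprn_gt0 ?divr_gt0// ltr_pdivrMr ?exprn_gt0 ?ltr_wpDl//; nra.
Qed.

Section ball_measure.
Context {R : realType} {d : nat} (mu : probability (borelRd R d) R).
Local Notation T := (borelRd R d).

Definition ballm (e : R) (x : T) : R := fine (mu (eball x e)).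

Lemma ballmE e x : (ballm e x)%:E = mu (eball x e).
Proof. by rewrite fineK// fin_num_measure//; exact: measurable_eball. Qed.

Lemma ballm_ge0 e x : 0 <= ballm e x.
Proof. by rewrite fine_ge0. Qed.

Lemma ballm_le1 e x : ballm e x <= 1.
Proof. by rewrite -lee_fin ballmE probability_le1//; exact: measurable_eball. Qed.

Lemma le_ballm e e' x y : eball x e `<=` eball y e' -> ballm e x <= ballm e' y.
Proof.
by move=> xy; rewrite -lee_fin !ballmE le_measure// inE; exact: measurable_eball.
Qed.

(** The ball around [x] is the section at [x] of the product-measurable set of pairs at distance
    less than [e]. *)
Lemma measurable_ballm e : measurable_fun [set: T] (ballm e).
Proof.
apply: (@measurableT_comp _ _ _ _ _ _ fine) => //.
have mA : measurable [set p : T * T | eball p.1 e p.2].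
  exact: (measurable_near _ measurable_fst measurable_snd).
rewrite (_ : (fun _ => _) = mu \o xsection [set p : T * T | eball p.1 e p.2]).
  exact: measurable_fun_xsection.
apply/funext => x /=; congr (mu _); apply/seteqP; split => y /=.
  by rewrite /xsection/= inE.
by rewrite /xsection/= inE.
Qed.

Lemma measurable_ballmV e : measurable_fun [set: T] (fun x => (ballm e x)^-1).
Proof.
rewrite (_ : (fun _ => _) = (@powR R)^~ (-1) \o ballm e).
  exact: (measurableT_comp (measurable_powR _) (measurable_ballm e)).
by apply/funext => x /=; rewrite powR_inv1// ballm_ge0.
Qed.

Lemma integral_indic_eball e (x : T) :
  (\int[mu]_y (\1_(eball x e) y)%:E = (ballm e x)%:E)%E.
Proof. by rewrite integral_indic// ?setIT ?ballmE//; exact: measurable_eball. Qed.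

End ball_measure.

(* The ball B(x, e) is covered by a bounded number of balls B_i of radius e / 2, and
   mu(B(y, e)) >= mu(B_i) for y in B_i, so that each B_i contributes at most 1. *)
Lemma ball_density_bound (R : realType) (d : nat) : exists C : R, 0 <= C /\
  forall (mu : probability (borelRd R d) R) (x : borelRd R d) (e : R), 0 < e ->
    (\int[mu]_y (\1_(eball x e) y * (ballm mu e y)^-1)%:E <= C%:E)%E.
Proof.
have [I [q qP]] := eball_half_cover R d.
exists #|I|%:R; split => // mu x e e0.
pose B i : set (borelRd R d) := eball (x + e *: q i) (e / 2).
have mB i : measurable (B i) by exact: measurable_eball.
apply: (@le_trans _ _ (\int[mu]_y \sum_(i <- index_enum I) (inve (mu (B i)) * (\1_(B i) y)%:E))%E).
  apply: ge0_le_integral => //.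
  - by move=> y _; rewrite lee_fin mulr_ge0// invr_ge0 ballm_ge0.
  - apply/measurable_EFinP/measurable_funM.
      by apply: measurable_indic; exact: measurable_eball.
    exact: measurable_ballmV.
  - apply: emeasurable_sum => i; apply: measurable_funeM.
    by apply/measurable_EFinP; exact: measurable_indic.
  move=> y _; have [yx|yx] := pselect (eball x e y); last first.
    rewrite indicE memNset// mul0r sume_ge0// => i _.
    by rewrite mule_ge0// ?inve_ge0.
  have [i yi] := qP _ _ e0 _ yx.
  rewrite (bigD1_seq i) ?mem_index_enum ?index_enum_uniq//=.
  rewrite [leLHS](_ : _ = (ballm mu e y)^-1%:E + 0)%E; last first.
    by rewrite adde0 indicE mem_set// mul1r.
  rewrite leeD ?sume_ge0//; last by move=> j _; rewrite mule_ge0// ?inve_ge0.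
  rewrite indicE mem_set// mule1.
  have := measure_ge0 mu (B i); rewrite le_eqVlt => /predU1P[<-|B0].
    by rewrite inve0 leey.
  have Bb : (mu (B i) <= (ballm mu e y)%:E)%E.
    rewrite ballmE le_measure// ?inE//; first exact: measurable_eball.
    by move=> z zi; exact: (eball_half yi zi).
  have b0 : 0 < ballm mu e y by rewrite -lte_fin (lt_le_trans B0).
  rewrite (_ : ((ballm mu e y)^-1)%:E = ((ballm mu e y)%:E^-1)%E); last first.
    by rewrite inver gt_eqF.
  by rewrite lee_pV2 ?inE// lee_fin ballm_ge0.
rewrite ge0_integral_sum//; last 2 first.
- move=> i; apply: measurable_funeM.
  by apply/measurable_EFinP; exact: measurable_indic.
- by move=> i y _; rewrite mule_ge0// ?inve_ge0.
apply: (@le_trans _ _ (\sum_(i <- index_enum I) 1)%E).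
  apply: lee_sum => i _.
  rewrite ge0_integralZl//; last 2 first.
  - by apply/measurable_EFinP; exact: measurable_indic.
  - by rewrite inve_ge0.
  have -> : (\int[mu]_y (\1_(B i) y)%:E = mu (B i))%E by rewrite integral_indic// setIT.
  (* For a null [B i] the inverse is [+oo], and the product is 0 by the convention [+oo * 0 = 0]. *)
  have [->|B0] := eqVneq (mu (B i)) 0%E; first by rewrite mule0.
  by rewrite mulVe// fin_num_measure.
by rewrite sumEFin sumr_const.
Qed.

(** * Independence of coordinates *)

Lemma integral_probability1 d (T : measurableType d) (R : realType) (P : probability T R) :
  (\int[P]_w 1%:E = 1)%E.
Proof. by rewrite integral_cst// mul1e; exact: probability_setT. Qed.

Section cylinders.
Context {R : realType} {d : nat} (mu : probability (borelRd R d) R)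
  (P : probability (seqRd R d) R).
Hypothesis P_prod : is_product_measure mu P.
Local Notation T := (borelRd R d).
Local Notation W := (seqRd R d).
Implicit Types (A : nat -> set T) (u v : W -> R).

Definition cylinder (m n : nat) A : set W :=
  [set w : nat -> 'rV[R]_d | forall k, (m <= k < n)%N -> A k (w k)].

Lemma measurable_seqRd_coord k : measurable_fun [set: W] (fun w : W => (w : nat -> 'rV[R]_d) k : T).
Proof. by move=> _ B mB; rewrite setTI; apply: sub_sigma_algebra; exists k, B. Qed.

Lemma measurable_cylinder m n A : (forall k, measurable (A k)) ->
  measurable (cylinder m n A).
Proof.
move=> mA; rewrite (_ : cylinder m n A =
    \bigcap_k (if (m <= k < n)%N then [set w : W | A k ((w : nat -> 'rV[R]_d) k)] else setT)).
  apply: bigcapT_measurable => k; case: ifPn => // _.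
  by have := measurable_seqRd_coord k measurableT (mA k); rewrite setTI.
apply/seteqP; split => w /=.
  by move=> h k _; case: ifPn => // kmn; exact: h.
by move=> h k kmn; have := h k Logic.I; rewrite kmn.
Qed.

(* [u] is independent of the coordinates of index at least [m]. *)
Definition indep_from (m : nat) u : Prop :=
  [/\ measurable_fun setT u, (forall w, 0 <= u w) &
   forall n A, (forall k, measurable (A k)) -> (m <= n)%N ->
    (\int[P]_w (u w * \1_(cylinder m n A) w)%:E =
     \int[P]_w (u w)%:E * \prod_(m <= k < n) mu (A k))%E].

Lemma indep_from0 : indep_from 0 (cst 1).
Proof.
split => // n A mA _ /=.
under eq_integral do rewrite mul1r.
rewrite integral_indic//; last exact: measurable_cylinder.
rewrite setIT integral_probability1 mul1e big_mkord -P_prod//.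
Qed.

(** The induction step for products over successive blocks: [v] depends only on the coordinates in
    [m, n), so multiplying by it multiplies expectations and leaves the coordinates from [n] on
    independent. *)
Lemma indep_fromM (I : Type) (s : seq I) (m n : nat) u (c : I -> R) (A : I -> nat -> set T) :
  (m <= n)%N -> indep_from m u -> (forall i, 0 <= c i) ->
  (forall i k, measurable (A i k)) ->
  let v w := \sum_(i <- s) c i * \1_(cylinder m n (A i)) w in
  indep_from n (fun w => u w * v w) /\
  (\int[P]_w (u w * v w)%:E =
   \int[P]_w (u w)%:E * \sum_(i <- s) ((c i)%:E * \prod_(m <= k < n) mu (A i k)))%E.
Proof.
move=> mn [mu_ u0 uE] c0 mA v.
have mv : measurable_fun setT v.
  apply: measurable_sum => i; apply: measurable_funM => //.
  by apply: measurable_indic; exact: measurable_cylinder.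
have v0 w : 0 <= v w by rewrite sumr_ge0// => i _; rewrite mulr_ge0.
have eint0 : (0 <= \int[P]_w (u w)%:E)%E.
  by apply: integral_ge0 => w _; rewrite lee_fin.
have key n' B : (n <= n')%N -> (forall k, measurable (B k)) ->
   (\int[P]_w (u w * v w * \1_(cylinder n n' B) w)%:E =
   \int[P]_w (u w)%:E * (\sum_(i <- s) ((c i)%:E * \prod_(m <= k < n) mu (A i k))) *
      \prod_(n <= k < n') mu (B k))%E.
  move=> nn' mB.
  (* A cylinder on [m, n) and one on [n, n') intersect in a single cylinder on [m, n'), to which the
     independence of [u] applies. *)
  pose C i k := if (k < n)%N then A i k else B k.
  have mC i k : measurable (C i k) by rewrite /C; case: ifP.
  transitivity (\int[P]_w (\sum_(i <- s) (c i)%:E * (u w * \1_(cylinder m n' (C i)) w)%:E)%E)%E.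
    apply: eq_integral => w _; rewrite /v mulr_sumr mulr_suml.
    rewrite [RHS](_ : _ = \sum_(i <- s) (c i * (u w * \1_(cylinder m n' (C i)) w))%:E)%E;
      last first.
      by apply: eq_bigr => i _; rewrite EFinM.
    rewrite sumEFin; congr EFin; apply: eq_bigr => i _.
    rewrite mulrCA -!mulrA; congr (_ * (_ * _)).
    rewrite !indicE -natrM mulnb; congr ((nat_of_bool _)%:R).
    rewrite -in_setI; apply/idP/idP; rewrite !inE /cylinder/=.
      move=> [h1 h2] k /andP[mk kn']; rewrite /C; case: ltnP => kn.
        by apply: h1; rewrite mk.
      by apply: h2; rewrite kn.
    move=> h; split => k /andP[k1 k2].
      by have := h k; rewrite /C k2 k1/=; apply; exact: leq_trans nn'.
    by have := h k; rewrite /C [(k < n)%N]ltnNge k1/= k2 andbT; apply; exact: leq_trans k1.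
  rewrite ge0_integral_sum//; last 2 first.
  - move=> i; apply: measurable_funeM; apply/measurable_EFinP.
    apply: measurable_funM => //.
    by apply: measurable_indic; exact: measurable_cylinder.
  - by move=> i w _; rewrite mule_ge0// lee_fin ?mulr_ge0.
  rewrite -muleA ge0_sume_distrl; last first.
    by move=> i _; rewrite mule_ge0 ?lee_fin ?prode_ge0.
  rewrite ge0_sume_distrr; last first.
    by move=> i _; rewrite !mule_ge0 ?lee_fin ?prode_ge0.
  apply: eq_bigr => i _.
  rewrite ge0_integralZl//; last 3 first.
  - apply/measurable_EFinP; apply: measurable_funM => //.
    by apply: measurable_indic; exact: measurable_cylinder.
  - by move=> w _; rewrite lee_fin mulr_ge0.
  - by rewrite lee_fin.
  rewrite uE//; last exact: leq_trans nn'.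
  rewrite (_ : (\prod_(m <= k < n') mu (C i k) =
      \prod_(m <= k < n) mu (A i k) * \prod_(n <= k < n') mu (B k))%E).
    by rewrite [in RHS]muleCA -muleA; congr (_ * _)%E; rewrite muleCA.
  rewrite (big_cat_nat mn nn')/=; congr (_ * _)%E.
    by apply: eq_big_nat => k /andP[_ kn]; rewrite /C kn.
  by apply: eq_big_nat => k /andP[kn _]; rewrite /C ltnNge kn.
have E1 : (\int[P]_w (u w * v w)%:E =
   \int[P]_w (u w)%:E * \sum_(i <- s) ((c i)%:E * \prod_(m <= k < n) mu (A i k)))%E.
  have := key n (fun=> setT) (leqnn _) (fun=> measurableT).
  rewrite big_geq// mule1 => <-; apply: eq_integral => w _.
  rewrite (_ : cylinder _ _ _ = setT) ?indicT ?mulr1//.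
  by apply/seteqP; split.
split => //; split.
- exact: measurable_funM.
- by move=> w; rewrite mulr_ge0.
- by move=> n' B mB nn'; rewrite key// E1.
Qed.

Lemma expectation_prod_cylinders (I : Type) (a : nat -> nat) (s : nat -> seq I)
    (c : nat -> I -> R) (A : nat -> I -> nat -> set T) :
  (forall j, a j <= a j.+1)%N -> (forall j i, 0 <= c j i) ->
  (forall j i k, measurable (A j i k)) -> forall n,
  (\int[P]_w (\prod_(j < n) \sum_(i <- s j) c j i * \1_(cylinder (a j) (a j.+1) (A j i)) w)%:E =
   \prod_(j < n) \sum_(i <- s j) ((c j i)%:E * \prod_(a j <= k < a j.+1) mu (A j i k)))%E.
Proof.
move=> ha hc hA n.
(* The induction also carries the independence of the partial product from the later coordinates. *)
suff [] : indep_from (a n) (fun w =>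
  \prod_(j < n) \sum_(i <- s j) c j i * \1_(cylinder (a j) (a j.+1) (A j i)) w) /\
  (\int[P]_w (\prod_(j < n) \sum_(i <- s j) c j i * \1_(cylinder (a j) (a j.+1) (A j i)) w)%:E =
   \prod_(j < n) \sum_(i <- s j) ((c j i)%:E * \prod_(a j <= k < a j.+1) mu (A j i k)))%E by [].
elim: n => [|n [IH1 IH2]].
  rewrite big_ord0; under eq_fun do rewrite big_ord0; under eq_integral do rewrite big_ord0.
  split; last exact: integral_probability1.
  have [_ _ h0] := indep_from0.
  split => // n A' mA' an.
  under eq_integral do rewrite mul1r.
  rewrite integral_indic//; last exact: measurable_cylinder.
  rewrite setIT integral_probability1 mul1e.
  (* Coordinates below [a 0] are left unconstrained, so that the cylinder becomes one starting at 0
     and the product formula for [P] applies. *)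
  pose B k := if (a 0 <= k)%N then A' k else setT.
  have mB k : measurable (B k) by rewrite /B; case: ifP.
  have := h0 n B mB (leq0n _); rewrite /=.
  under eq_integral do rewrite mul1r.
  rewrite integral_indic//; last exact: measurable_cylinder.
  rewrite setIT integral_probability1 mul1e.
  rewrite (_ : cylinder 0 n B = cylinder (a 0) n A').
    move=> ->; rewrite (big_cat_nat (leq0n _) an)/= big_nat big1 ?mul1e.
      by apply: eq_big_nat => k /andP[k1 _]; rewrite /B k1.
    move=> k /andP[_ ka]; rewrite /B leqNgt ka/=; exact: probability_setT.
  apply/seteqP; split => w h k /=.
    by move=> /andP[k1 k2]; have := h k; rewrite /B k1; exact.
  by rewrite /B; case: ifPn => // k1 k2; apply: h; rewrite k1.
have [h1 h2] := indep_fromM (s n) (ha n) IH1 (hc n) (hA n).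
split; last first.
  rewrite big_ord_recr/= -IH2 -h2; apply: eq_integral => w _.
  by rewrite big_ord_recr.
by under eq_fun do rewrite big_ord_recr.
Qed.

End cylinders.

(** * The energy kernel *)

Lemma geometric_nneseries_le (R : realType) (c z : R) (f : nat -> \bar R) :
  0 <= c -> 0 < z < 1 -> (forall m, 0 <= f m <= (c * z ^+ m)%:E)%E ->
  (\sum_(0 <= m <oo) f m <= (c / (1 - z))%:E)%E.
Proof.
move=> c0 /andP[z0 z1] hf.
apply: lime_le; first by apply: is_cvg_nneseries => m _ _; have /andP[] := hf m.
apply: nearW => n.
apply: (@le_trans _ _ (\sum_(0 <= m < n) (c * z ^+ m)%:E)%E).
  by apply: lee_sum => m _; have /andP[] := hf m.
by rewrite sumEFin lee_fin; apply: geometric_le_lim => //; rewrite gtr0_norm.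
Qed.

Section kernel_functions.
Context {R : realType} {d : nat}.
Local Notation T := (borelRd R d).
Implicit Types (x y : T) (tau : R).

(* For tau = 2^t with t > 0, this is +oo on the diagonal and comparable to
   1 + |x - y|^-t elsewhere. *)
Definition riesz tau x y : \bar R :=
  (1 + \sum_(0 <= m <oo) (tau ^+ m * \1_(eball x (2 / 2 ^+ m)) y)%:E)%E.

Lemma measurable_indic_near d' (S : measurableType d') (f g : S -> T) (e : R) :
  measurable_fun setT f -> measurable_fun setT g ->
  measurable_fun setT (fun s => \1_(eball (f s) e) (g s) : R).
Proof.
move=> mf mg.
rewrite (_ : (fun _ => _) = \1_[set s | eball (f s) e (g s)]).
  by apply: measurable_indic; exact: measurable_near.
by apply/funext => s; rewrite !indicE; congr (nat_of_bool _)%:R; apply/idP/idP; rewrite !inE.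
Qed.

Lemma riesz_term_ge0 tau x y m : 0 <= tau ->
  (0 <= (tau ^+ m * \1_(eball x (2 / 2 ^+ m)) y)%:E)%E.
Proof. by move=> t0; rewrite lee_fin mulr_ge0// exprn_ge0. Qed.

Lemma riesz_ge1 tau x y : 0 <= tau -> (1 <= riesz tau x y)%E.
Proof. by move=> t0; rewrite /riesz leeDl// nneseries_ge0// => m _ _; exact: riesz_term_ge0. Qed.

Lemma riesz_ge0 tau x y : 0 <= tau -> (0 <= riesz tau x y)%E.
Proof. by move=> t0; rewrite (le_trans _ (riesz_ge1 _ _ _)). Qed.

Lemma riesz_ge tau x y m : 0 <= tau -> eball x (2 / 2 ^+ m) y ->
  ((tau ^+ m)%:E <= riesz tau x y)%E.
Proof.
move=> t0 xy; rewrite /riesz.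
apply: (@le_trans _ _ (\sum_(0 <= m <oo) (tau ^+ m * \1_(eball x (2 / 2 ^+ m)) y)%:E)%E);
  last first.
  by rewrite leeDr.
apply: le_trans (nneseries_lim_ge m.+1 _); last by move=> k _ _; exact: riesz_term_ge0.
rewrite big_nat_recr//= indicE mem_set// mulr1 leeDr// sume_ge0// => k _.
exact: riesz_term_ge0.
Qed.

Lemma measurable_riesz tau d' (S : measurableType d') (f g : S -> T) : 0 <= tau ->
  measurable_fun setT f -> measurable_fun setT g ->
  measurable_fun setT (fun s => riesz tau (f s) (g s)).
Proof.
move=> t0 mf mg; apply: emeasurable_funD => //.
apply: ge0_emeasurable_sum => [m s _ _|m _]; first exact: riesz_term_ge0.
apply/measurable_EFinP; apply: measurable_funM => //.
exact: measurable_indic_near.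
Qed.

Context (mu : probability T R).

(** Term by term, the weight [tau ^+ m] turns the bound on the ball of radius 2/2^m into
    [c * z ^+ m]. The geometric series gives [c / (1 - z)], and [c0] accounts for the constant term
    of the kernel. *)
Lemma integral_riesz_le (tau c c0 z : R) (f : T -> R) x :
  0 <= tau -> 0 <= c -> 0 < z < 1 -> measurable_fun setT f -> (forall y, 0 <= f y) ->
  (\int[mu]_y (f y)%:E <= c0%:E)%E ->
  (forall m, \int[mu]_y (\1_(eball x (2 / 2 ^+ m)) y * f y)%:E <= (c * (z / tau) ^+ m)%:E)%E ->
  0 < tau ->
  (\int[mu]_y (riesz tau x y * (f y)%:E) <= (c0 + c / (1 - z))%:E)%E.
Proof.
move=> t0 c_ge0 z01 mf f0 h0 h t1.
have mi m : measurable_fun [set: T] (fun y => (tau ^+ m * \1_(eball x (2 / 2 ^+ m)) y * f y)%:E).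
  apply/measurable_EFinP; apply: measurable_funM => //; apply: measurable_funM => //.
  exact: measurable_indic_near.
rewrite (_ : (fun y => _) = (fun y => (f y)%:E +
    \sum_(0 <= m <oo) (tau ^+ m * \1_(eball x (2 / 2 ^+ m)) y * f y)%:E)%E); last first.
  apply/funext => y; rewrite /riesz ge0_muleDl//; last first.
    by apply: nneseries_ge0 => m _ _; exact: riesz_term_ge0.
  rewrite mul1e; congr (_ + _)%E.
  rewrite muleC -nneseriesZl//; last by move=> m _; exact: riesz_term_ge0.
  by apply: eq_eseriesr => m _; rewrite -EFinM mulrC.
have ti m y : (0 <= (tau ^+ m * \1_(eball x (2 / 2 ^+ m)) y * f y)%:E)%E.
  by rewrite lee_fin mulr_ge0// mulr_ge0// exprn_ge0.
rewrite ge0_integralD//; last 4 first.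
- by move=> y _; rewrite lee_fin.
- exact/measurable_EFinP.
- by move=> y _; apply: nneseries_ge0 => m _ _; exact: ti.
- by apply: ge0_emeasurable_sum => [m y _ _|m _]; [exact: ti|exact: mi].
rewrite EFinD leeD// integral_nneseries//.
apply: geometric_nneseries_le => // m.
apply/andP; split; first by apply: integral_ge0 => y _; exact: ti.
under eq_integral do rewrite -mulrA EFinM.
rewrite ge0_integralZl_EFin//; last 3 first.
- by move=> y _; rewrite lee_fin mulr_ge0.
- by apply/measurable_EFinP; apply: measurable_funM => //; exact: measurable_indic_near.
- by rewrite exprn_ge0.
apply: (@le_trans _ _ ((tau ^+ m)%:E * (c * (z / tau) ^+ m)%:E)%E).
  by rewrite lee_pmul2l// lte_fin exprn_gt0.
have tm0 : tau ^+ m != 0 by rewrite expf_neq0// gt_eqF.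
by rewrite -EFinM lee_fin expr_div_n mulrCA [tau ^+ m * _]mulrC divfK.
Qed.

End kernel_functions.

(** * Energy of a single random ball *)

Lemma minr_le_powRM (R : realType) (u v q : R) : 0 <= u -> 0 <= v -> 0 <= q <= 1 ->
  Num.min u v <= u `^ (1 - q) * v `^ q.
Proof.
move=> u0 v0 /andP[q0 q1]; set w := Num.min u v.
have w0 : 0 <= w by rewrite le_min u0.
have [-> |wn0] := eqVneq w 0; first by rewrite mulr_ge0// powR_ge0.
rewrite -[leLHS]powRr1// -[in leLHS](subrK q 1) powRD; last by rewrite wn0 implybT.
by rewrite ler_pM ?powR_ge0// ge0_ler_powR ?nnegrE ?subr_ge0// ge_min lexx ?orbT.
Qed.

Lemma powR_exprV (R : realType) (x u : R) (m : nat) : 0 <= x ->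
  (x ^- m) `^ u = (x `^ (- u)) ^+ m.
Proof.
move=> x0; rewrite -(powR_invn m x0) -(powR_mulrn m (powR_ge0 x (- u))) -!powRrM.
by congr (x `^ _); rewrite !mulNr mulrC.
Qed.

Section pair_correlation.
Context {R : realType} {d : nat} (mu : probability (borelRd R d) R).
Local Notation T := (borelRd R d).
Context (F : set T) (A a b : R).
Hypotheses (mF : measurable F) (A0 : 0 < A).
Hypothesis ball_upper : forall x, F x -> forall e, 0 < e -> ballm mu e x <= A * e `^ a.
Hypothesis ball_lower : forall x, F x -> forall e, 0 < e <= 1 -> e `^ b <= A * ballm mu e x.
Implicit Types (x y : T) (e : R).

Definition density e x : R := \1_F x * (ballm mu e x)^-1.

(* The expectation over w of 1[w in B(x, e)] 1[w in B(y, e)] / (mu(B(x, e)) mu(B(y, e))),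
   for x and y in F. *)
Definition pair_density e x y : R :=
  density e x * density e y * fine (mu (eball x e `&` eball y e)).

Lemma density_ge0 e x : 0 <= density e x.
Proof. by rewrite mulr_ge0// invr_ge0 ballm_ge0. Qed.

Lemma measurable_density e : measurable_fun setT (density e).
Proof. by apply: measurable_funM; [exact: measurable_indic|exact: measurable_ballmV]. Qed.

Lemma ballm_gt0 e x : F x -> 0 < e <= 1 -> 0 < ballm mu e x.
Proof.
move=> Fx /andP[e0 e1]; rewrite -(pmulr_rgt0 _ A0).
by rewrite (lt_le_trans _ (ball_lower Fx _)) ?powR_gt0// e0.
Qed.

Lemma densityM_ballm e x : 0 < e <= 1 -> density e x * ballm mu e x = \1_F x.
Proof.
move=> e1; rewrite /density -mulrA; have [Fx|Fx] := pselect (F x).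
  by rewrite mulVf ?mulr1// gt_eqF// ballm_gt0.
by rewrite indicE memNset// mul0r.
Qed.

Lemma density_le e x : 0 < e <= 1 -> density e x <= A * e `^ (- b).
Proof.
move=> e1; have /andP[e0 _] := e1; rewrite /density.
have [Fx|Fx] := pselect (F x); last first.
  by rewrite indicE memNset// mul0r mulr_ge0 ?powR_ge0// ltW.
rewrite indicE mem_set// mul1r powRN -[leLHS]mul1r ler_pdivrMr ?ballm_gt0//.
by rewrite mulrAC ler_pdivlMr ?powR_gt0// mul1r; exact: ball_lower.
Qed.

Lemma density_le_inv e x : density e x <= (ballm mu e x)^-1.
Proof. by rewrite ler_piMl ?invr_ge0 ?ballm_ge0// indicE lern1 leq_b1. Qed.

Lemma measurable_eballI e x y : measurable (eball x e `&` eball y e : set T).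
Proof. by apply: measurableI; exact: measurable_eball. Qed.

Lemma eballI_measureE e x y :
  (fine (mu (eball x e `&` eball y e)))%:E = mu (eball x e `&` eball y e).
Proof. by rewrite fineK// fin_num_measure//; exact: measurable_eballI. Qed.

Lemma eballI_measure_le e x y : fine (mu (eball x e `&` eball y e)) <= ballm mu e y.
Proof.
rewrite -lee_fin eballI_measureE ballmE le_measure ?inE//.
- exact: measurable_eballI.
- exact: measurable_eball.
Qed.

Lemma pair_density_ge0 e x y : 0 <= pair_density e x y.
Proof. by rewrite mulr_ge0 ?fine_ge0// mulr_ge0 ?density_ge0//. Qed.

Lemma pair_density_le e x y : 0 < e <= 1 -> pair_density e x y <= density e x.
Proof.
move=> e1; rewrite /pair_density -mulrA ler_piMr ?density_ge0//.
apply: (@le_trans _ _ (density e y * ballm mu e y)).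
  by rewrite ler_wpM2l ?density_ge0 ?eballI_measure_le.
by rewrite densityM_ballm// indicE lern1 leq_b1.
Qed.

Lemma measurable_pair_density e d' (S : measurableType d') (f g : S -> T) :
  measurable_fun setT f -> measurable_fun setT g ->
  measurable_fun setT (fun s => pair_density e (f s) (g s)).
Proof.
move=> mf mg; apply: measurable_funM.
  by apply: measurable_funM; apply: (measurableT_comp (measurable_density e)).
apply: (@measurableT_comp _ _ _ _ _ _ fine) => //.
pose E := [set p : S * T | eball (f p.1) e p.2] `&` [set p : S * T | eball (g p.1) e p.2].
have mE : measurable E.
  apply: measurableI.
    apply: (@measurable_near _ _ _ _ (f \o fst) snd e); last exact: measurable_snd.
    exact: (measurableT_comp mf measurable_fst).
  apply: (@measurable_near _ _ _ _ (g \o fst) snd e); last exact: measurable_snd.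
  exact: (measurableT_comp mg measurable_fst).
rewrite (_ : (fun _ => _) = mu \o xsection E); first exact: measurable_fun_xsection.
apply/funext => s /=; congr (mu _); apply/seteqP; split => w /=.
  by rewrite /xsection/= inE.
by rewrite /xsection/= inE.
Qed.

(** The measure of the intersection is written as an integral over [w], and Tonelli lets [y] be
    integrated first. The [y]-integral over the ball around [w] is at most [C]; the remaining
    integral over the ball around [x] cancels [density e x]. The bound does not depend on [e]. *)
Lemma integral_pair_density_le (C e : R) x : 0 <= C -> 0 < e <= 1 ->
  (forall w, \int[mu]_y (\1_(eball w e) y * (ballm mu e y)^-1)%:E <= C%:E)%E ->
  (\int[mu]_y (pair_density e x y)%:E <= C%:E)%E.
Proof.
move=> C0 e1 hC.
pose h (p : T * T) := (density e x * \1_(eball x e) p.2 * (density e p.1 * \1_(eball p.1 e) p.2))%:E.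
have mh : measurable_fun setT h.
  apply/measurable_EFinP; apply: measurable_funM; apply: measurable_funM => //.
  - by apply: measurable_indic_near => //; exact: measurable_snd.
  - exact: (measurableT_comp (measurable_density e) measurable_fst).
  - exact: measurable_indic_near.
have h0 p : (0 <= h p)%E by rewrite lee_fin; apply: mulr_ge0; apply: mulr_ge0 => //;
  exact: density_ge0.
have -> : (\int[mu]_y (pair_density e x y)%:E = \int[mu]_y \int[mu]_w h (y, w))%E.
  apply: eq_integral => y _; rewrite /pair_density EFinM eballI_measureE.
  rewrite -[in LHS](setIT (_ `&` _)) -integral_indic//; last exact: measurable_eballI.
  rewrite -ge0_integralZl_EFin//; last 2 first.
  - by apply/measurable_EFinP; apply: measurable_indic; exact: measurable_eballI.
  - by rewrite mulr_ge0 ?density_ge0//.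
  apply: eq_integral => w _; rewrite -EFinM /h/=; congr EFin.
  by rewrite indicI /=; ring.
rewrite (fubini_tonelli h)//.
apply: (@le_trans _ _ (\int[mu]_w (density e x * C * \1_(eball x e) w)%:E)%E).
  apply: ge0_le_integral => //.
  - by move=> w _; apply: integral_ge0.
  - exact: (measurable_fun_fubini_tonelli_G h).
  - apply/measurable_EFinP; apply: measurable_funM => //.
    by apply: measurable_indic; exact: measurable_eball.
  move=> w _.
  have -> : (\int[mu]_y h (y, w) = (density e x * \1_(eball x e) w)%:E *
      \int[mu]_y (density e y * \1_(eball w e) y)%:E)%E.
    rewrite -(@ge0_integralZl_EFin _ _ _ mu _ measurableT
      (fun y => (density e y * \1_(eball w e) y)%:E)); last 3 first.
    - by move=> y _; rewrite lee_fin mulr_ge0 ?density_ge0//.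
    - apply/measurable_EFinP; apply: measurable_funM; first exact: measurable_density.
      by apply: measurable_indic; exact: measurable_eball.
    - by rewrite mulr_ge0 ?density_ge0//.
    apply: eq_integral => y _; rewrite -EFinM /h/=; congr (_ * (_ * _))%:E.
    by rewrite !indicE; congr (nat_of_bool _)%:R; apply/idP/idP; rewrite !inE eball_sym.
  rewrite [in leRHS]mulrAC [leRHS]EFinM lee_wpmul2l//; first by rewrite lee_fin;
    apply: mulr_ge0 => //; exact: density_ge0.
  apply: le_trans (hC w); apply: ge0_le_integral => //.
  - by move=> y _; rewrite lee_fin mulr_ge0 ?density_ge0//.
  - apply/measurable_EFinP; apply: measurable_funM; first exact: measurable_density.
    by apply: measurable_indic; exact: measurable_eball.
  - apply/measurable_EFinP; apply: measurable_funM; last exact: measurable_ballmV.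
    by apply: measurable_indic; exact: measurable_eball.
  - by move=> y _; rewrite lee_fin mulrC ler_wpM2l// density_le_inv.
under eq_integral do rewrite EFinM.
rewrite ge0_integralZl_EFin//; last 2 first.
- by apply/measurable_EFinP; apply: measurable_indic; exact: measurable_eball.
- by rewrite mulr_ge0 ?density_ge0//.
rewrite integral_indic_eball -EFinM lee_fin mulrAC densityM_ballm//.
by rewrite ler_piMl// indicE lern1 leq_b1.
Qed.

(** Here [pair_density] is bounded by [density e x], at most [A * e^(-b)] by the lower ball bound,
    and the ball of radius [r] has measure at most [A * r^a] by the upper one. *)
Lemma integral_near_pair_density_le (e r : R) x : 0 < e <= 1 -> 0 < r ->
  (\int[mu]_y (\1_(eball x r) y * pair_density e x y)%:E <= (A ^+ 2 * e `^ (- b) * r `^ a)%:E)%E.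
Proof.
move=> e1 r0.
apply: (@le_trans _ _ (\int[mu]_y (density e x * \1_(eball x r) y)%:E)%E).
  apply: ge0_le_integral => //.
  - by move=> y _; rewrite lee_fin mulr_ge0// pair_density_ge0.
  - apply/measurable_EFinP; apply: measurable_funM.
      by apply: measurable_indic; exact: measurable_eball.
    exact: measurable_pair_density.
  - apply/measurable_EFinP; apply: measurable_funM => //.
    by apply: measurable_indic; exact: measurable_eball.
  - by move=> y _; rewrite lee_fin mulrC ler_wpM2r// pair_density_le.
under eq_integral do rewrite EFinM.
rewrite ge0_integralZl_EFin//; last 2 first.
- by apply/measurable_EFinP; apply: measurable_indic; exact: measurable_eball.
- by rewrite density_ge0.
rewrite integral_indic_eball -EFinM lee_fin.
have [Fx|Fx] := pselect (F x); last first.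
  rewrite /density indicE memNset// !mul0r.
  by rewrite !mulr_ge0 ?powR_ge0 ?exprn_ge0// ltW.
rewrite [leRHS](_ : _ = (A * e `^ (- b)) * (A * r `^ a)); last by ring.
by rewrite ler_pM ?density_ge0 ?ballm_ge0 ?density_le ?ball_upper.
Qed.


(** The two preceding bounds are interpolated with exponent q = s/b, which turns e^(-b) into e^(-s).
    The radius 2/2^m then appears to the power a q > t, so its decay beats the growth 2^(t m) of the
    kernel. *)
Lemma integral_riesz_pair_density (s t : R) : 0 < s -> s <= b -> t < a * (s / b) ->
  exists2 C1, 0 <= C1 & forall e x, 0 < e <= 1 ->
    (\int[mu]_y (riesz (2 `^ t) x y * (pair_density e x y)%:E) <= (C1 * e `^ (- s))%:E)%E.
Proof.
move=> s0 sb tq.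
have b0 : 0 < b by rewrite (lt_le_trans s0).
have [C [C0 hC]] := ball_density_bound R d.
pose q := s / b.
have q01 : 0 <= q <= 1.
  by rewrite /q; apply/andP; split; [rewrite divr_ge0// ltW|rewrite ler_pdivrMr ?mul1r].
pose C2 := C `^ (1 - q) * (A `^ q) ^+ 2 * 2 `^ (a * q).
have C20 : 0 <= C2 by rewrite !mulr_ge0 ?exprn_ge0 ?powR_ge0.
pose z : R := 2 `^ (t - a * q).
have z01 : 0 < z < 1.
  rewrite powR_gt0//= /z -[ltRHS](powRr0 2).
  by rewrite /powR !pnatr_eq0/= ltr_expR ltr_pM2r ?subr_lt0// ln_gt0// ltr1n.
exists (C + C2 / (1 - z)).
  by rewrite addr_ge0// divr_ge0// subr_ge0 ltW; case/andP: z01.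
move=> e x e01; have /andP[e0 e1] := e01.
(* Since e <= 1, the constant [C] from the first term of the kernel can be absorbed into a multiple
   of e^(-s). *)
have es : 1 <= e `^ (- s).
  by rewrite powRN invf_ge1 ?powR_gt0// -[leRHS](powRr0 e) ger_powR ?e0// ltW.
apply: (@le_trans _ _ (C + (C2 * e `^ (- s)) / (1 - z))%:E); last first.
  by rewrite lee_fin mulrDl lerD// ?ler_peMr// mulrAC.
apply: integral_riesz_le => //.
- by rewrite mulr_ge0// powR_ge0.
- exact: measurable_pair_density.
- by move=> y; exact: pair_density_ge0.
- by apply: integral_pair_density_le => // w; exact: hC.
- move=> m; have r0 : 0 < 2 / 2 ^+ m :> R by rewrite divr_gt0// exprn_gt0.
  pose v := A ^+ 2 * e `^ (- b) * (2 / 2 ^+ m) `^ a.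
  have v0 : 0 <= v by rewrite !mulr_ge0 ?powR_ge0 ?exprn_ge0// ltW.
  apply: (@le_trans _ _ (Num.min C v)%:E).
    rewrite EFin_min le_min integral_near_pair_density_le// andbT.
    apply: le_trans (integral_pair_density_le x C0 e01 _); last by move=> w; exact: hC.
    apply: ge0_le_integral => //.
    + by move=> y _; rewrite lee_fin mulr_ge0// pair_density_ge0.
    + apply/measurable_EFinP; apply: measurable_funM.
        by apply: measurable_indic; exact: measurable_eball.
      exact: measurable_pair_density.
    + by apply/measurable_EFinP; exact: measurable_pair_density.
    + by move=> y _; rewrite lee_fin ler_piMl ?pair_density_ge0// indicE lern1 leq_b1.
  rewrite lee_fin (le_trans (minr_le_powRM C0 v0 q01))//.
  rewrite /v !powRM ?mulr_ge0 ?powR_ge0 ?exprn_ge0 ?invr_ge0 ?exprn_ge0 ?(ltW A0)//.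
  rewrite -!powRrM.
  have -> : - b * q = - s by rewrite /q mulNr mulrCA divff ?mulr1// gt_eqF.
  rewrite (powR_exprV (a * q) m (ler0n R 2)).
  have -> : z / 2 `^ t = 2 `^ (- (a * q)).
    by rewrite /z powRD ?pnatr_eq0 ?implybT// mulrAC mulfV ?mul1r// gt_eqF// powR_gt0.
  by rewrite /C2 le_eqVlt; apply/orP; left; apply/eqP; ring.
Qed.

(** Bounds the potential of [mu] itself on [F], which is the base case of the energy estimate before
    any block has been multiplied in. *)
Lemma integral_riesz_le_cst (t : R) : t < a ->
  exists2 C1, 0 <= C1 & forall x, F x ->
    (\int[mu]_y riesz (2 `^ t) x y <= C1%:E)%E.
Proof.
move=> ta.
pose z : R := 2 `^ (t - a).
have z01 : 0 < z < 1.
  rewrite powR_gt0//= /z -[ltRHS](powRr0 2).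
  by rewrite /powR !pnatr_eq0/= ltr_expR ltr_pM2r ?subr_lt0// ln_gt0// ltr1n.
pose c := A * 2 `^ a.
have c0 : 0 <= c by rewrite mulr_ge0 ?powR_ge0// ltW.
exists (1 + c / (1 - z)).
  by rewrite addr_ge0// divr_ge0// subr_ge0 ltW; case/andP: z01.
move=> x Fx; under eq_integral do rewrite -[riesz _ _ _]mule1.
apply: (@integral_riesz_le _ _ _ _ _ _ _ (cst 1)) => //.
- by rewrite integral_probability1.
- move=> m; under eq_integral do rewrite /= mulr1.
  have r0 : 0 < 2 / 2 ^+ m :> R by rewrite divr_gt0// exprn_gt0.
  rewrite integral_indic_eball lee_fin (le_trans (ball_upper Fx r0))//.
  rewrite powRM ?invr_ge0 ?exprn_ge0// mulrA ler_wpM2l//.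
  have -> : z / 2 `^ t = 2 `^ (- a).
    by rewrite /z powRD ?pnatr_eq0 ?implybT// mulrAC mulfV ?mul1r// gt_eqF// powR_gt0.
  by rewrite (powR_exprV a m (ler0n R 2)).
Qed.

End pair_correlation.

(** * Random densities *)

Lemma lee_prod (R : realType) (I : Type) (s : seq I) (f g : I -> \bar R) :
  (forall i, 0 <= f i <= g i)%E -> (\prod_(i <- s) f i <= \prod_(i <- s) g i)%E.
Proof.
move=> fg; elim: s => [|i s IH]; first by rewrite !big_nil.
rewrite !big_cons; have /andP[f0 fgi] := fg i.
by rewrite lee_pmul// prode_ge0// => j _; have /andP[] := fg j.
Qed.

Section cascade.
Context {R : realType} {d : nat} (mu : probability (borelRd R d) R)
  (P : probability (seqRd R d) R).
Hypothesis P_prod : is_product_measure mu P.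
Local Notation T := (borelRd R d).
Local Notation W := (seqRd R d).
Context (F : set T) (A b : R).
Hypotheses (mF : measurable F) (A0 : 0 < A).
Hypothesis ball_lower : forall x, F x -> forall e, 0 < e <= 1 -> e `^ b <= A * ballm mu e x.
Context (rho : nat -> R) (s : R) (blk : nat -> nat).
Hypothesis rho01 : forall k, (blk 0 <= k)%N -> 0 < rho k <= 1.
Hypothesis blk_le : forall j, (blk j <= blk j.+1)%N.

Definition block_sum j := \sum_(blk j <= k < blk j.+1) rho k `^ s.
Hypothesis block_sum_gt0 : forall j, 0 < block_sum j.

Definition coef j k := rho k `^ s / block_sum j.

Definition weight j (x : T) (w : W) : R :=
  \sum_(blk j <= k < blk j.+1)
    coef j k * density mu F (rho k) x * \1_(eball x (rho k)) ((w : nat -> 'rV[R]_d) k).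

Definition cascade n (x : T) (w : W) : R := \1_F x * \prod_(j < n) weight j x w.

(** The diagonal part of the expectation of [weight j x * weight j y] for [x] and [y] in [F]; the
    off-diagonal part adds at most 1. *)
Definition correlation j (x y : T) : R :=
  \sum_(blk j <= k < blk j.+1) coef j k ^+ 2 * pair_density mu F (rho k) x y.

Lemma blk_ge0 j : (blk 0 <= blk j)%N.
Proof. by elim: j => // j IH; exact: leq_trans (blk_le j). Qed.

Lemma rho01_blk j k : (blk j <= k)%N -> 0 < rho k <= 1.
Proof. by move=> jk; apply: rho01; exact: leq_trans (blk_ge0 j) jk. Qed.

Lemma coef_ge0 j k : 0 <= coef j k.
Proof. by apply: divr_ge0; [exact: powR_ge0|exact: ltW]. Qed.

Lemma sum_coef j : \sum_(blk j <= k < blk j.+1) coef j k = 1.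
Proof. by rewrite -mulr_suml divff// gt_eqF//; exact: block_sum_gt0. Qed.

Lemma coef_le1 j k : (blk j <= k < blk j.+1)%N -> coef j k <= 1.
Proof.
move=> kj; rewrite -(sum_coef j) (bigD1_seq k) ?mem_index_iota ?iota_uniq//=.
by rewrite lerDl sumr_ge0// => i _; exact: coef_ge0.
Qed.

Lemma weight_ge0 j x w : 0 <= weight j x w.
Proof. by apply: sumr_ge0 => k _; apply: mulr_ge0 => //; apply: mulr_ge0;
  [exact: coef_ge0|exact: density_ge0]. Qed.

Lemma cascade_ge0 n x w : 0 <= cascade n x w.
Proof. by rewrite mulr_ge0// prodr_ge0// => j _; exact: weight_ge0. Qed.

Lemma cascade_notin n x w : ~ F x -> cascade n x w = 0.
Proof. by move=> Fx; rewrite /cascade indicE memNset// mul0r. Qed.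

Lemma correlation_ge0 j x y : 0 <= correlation j x y.
Proof. by apply: sumr_ge0 => k _; apply: mulr_ge0; [exact: sqr_ge0|exact: pair_density_ge0]. Qed.

Lemma measurable_cascade n d' (S : measurableType d') (f : S -> T) (g : S -> W) :
  measurable_fun setT f -> measurable_fun setT g ->
  measurable_fun setT (fun p => cascade n (f p) (g p)).
Proof.
move=> mf mg; apply: measurable_funM.
  by apply: (measurableT_comp _ mf); exact: measurable_indic.
apply: measurable_prod => j _; apply: measurable_sum => k.
apply: measurable_funM.
  apply: measurable_funM => //.
  exact: (measurableT_comp (measurable_density mu mF (rho k)) mf).
apply: measurable_indic_near => //.
exact: (measurableT_comp (measurable_seqRd_coord k) mg).
Qed.

Lemma measurable_correlation j d' (S : measurableType d') (f g : S -> T) :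
  measurable_fun setT f -> measurable_fun setT g ->
  measurable_fun setT (fun p => correlation j (f p) (g p)).
Proof.
move=> mf mg; apply: measurable_sum => k; apply: measurable_funM => //.
exact: measurable_pair_density.
Qed.

(** By independence the expectation is a product over the blocks. In each block the normalization by
    the ball measure leaves the sum of the coefficients, which is 1. *)
Lemma expectation_cascade n x : F x -> (\int[P]_w (cascade n x w)%:E = 1)%E.
Proof.
move=> Fx.
pose c j k := coef j k * density mu F (rho k) x.
(* The event that the [k]-th centre is near [x], as a cylinder constraining one coordinate of the
   block. *)
pose B (j k i : nat) : set T := if i == k then eball x (rho k) else setT.
have mB j k i : measurable (B j k i).
  by rewrite /B; case: ifP => // _; exact: measurable_eball.
have c0 j k : 0 <= c j k by apply: mulr_ge0; [exact: coef_ge0|exact: density_ge0].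
transitivity (\int[P]_w (\prod_(j < n) \sum_(k <- index_iota (blk j) (blk j.+1))
    c j k * \1_(cylinder (blk j) (blk j.+1) (B j k)) w)%:E)%E.
  apply: eq_integral => w _; rewrite /cascade indicE mem_set// mul1r; congr EFin.
  apply: eq_bigr => j _; apply: eq_big_nat => k kj; rewrite /c; congr (_ * _).
  rewrite !indicE; congr (nat_of_bool _)%:R; apply/idP/idP; rewrite !inE /cylinder/=.
    by move=> xk i _; rewrite /B; case: eqVneq => // ->.
  by move=> /(_ _ kj); rewrite /B eqxx.
rewrite (expectation_prod_cylinders P_prod (fun j =>
  index_iota (blk j) (blk j.+1)) blk_le c0 mB) big1// => j _.
rewrite (eq_big_nat _ _ (F2 := fun k => (coef j k)%:E)); last first.
  move=> k /[dup] kj /andP[k1 k2].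
  rewrite (bigD1_seq k) ?mem_index_iota ?iota_uniq//= big1 ?mule1; last first.
    by move=> i ik; rewrite /B (negbTE ik); exact: probability_setT.
  rewrite /B eqxx -ballmE -EFinM /c -mulrA.
  by rewrite (densityM_ballm A0 ball_lower) ?(rho01_blk k1)// indicE mem_set// mulr1.
by rewrite sumEFin sum_coef.
Qed.

(** Expanding both block sums gives index pairs (k, l). For distinct indices the constraints concern
    different coordinates and contribute [coef j k * coef j l]; for equal ones the intersection of
    the two balls produces [pair_density]. *)
Lemma expectation_cascadeM_le n x y : F x -> F y ->
  (\int[P]_w (cascade n x w * cascade n y w)%:E <= (\prod_(j < n) (1 + correlation j x y))%:E)%E.
Proof.
move=> Fx Fy.
pose c j (kl : nat * nat) := (coef j kl.1 * density mu F (rho kl.1) x) *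
  (coef j kl.2 * density mu F (rho kl.2) y).
pose Bx (k i : nat) : set T := if i == k then eball x (rho k) else setT.
pose By (k i : nat) : set T := if i == k then eball y (rho k) else setT.
pose B (j : nat) (kl : nat * nat) i := Bx kl.1 i `&` By kl.2 i.
have mBx k i : measurable (Bx k i).
  by rewrite /Bx; case: ifP => // _; exact: measurable_eball.
have mBy k i : measurable (By k i).
  by rewrite /By; case: ifP => // _; exact: measurable_eball.
have mB j kl i : measurable (B j kl i) by exact: measurableI.
have c0 j kl : 0 <= c j kl by apply: mulr_ge0; apply: mulr_ge0;
  (exact: coef_ge0 || exact: density_ge0).
pose I j := index_iota (blk j) (blk j.+1).
have -> : (\int[P]_w (cascade n x w * cascade n y w)%:E =
  \int[P]_w (\prod_(j < n) \sum_(kl <- [seq (k, l) | k <- I j, l <- I j])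
    c j kl * \1_(cylinder (blk j) (blk j.+1) (B j kl)) w)%:E)%E.
  apply: eq_integral => w _; rewrite /cascade !indicE !mem_set// !mul1r; congr EFin.
  rewrite -big_split/=; apply: eq_bigr => j _; rewrite /weight big_distrlr/= big_allpairs.
  apply: eq_big_nat => k kj; apply: eq_big_nat => l lj; rewrite /c/= mulrACA; congr (_ * _).
  rewrite !indicE -natrM mulnb; congr (nat_of_bool _)%:R.
  apply/idP/idP; rewrite !inE /cylinder/=.
    move=> /andP[]; rewrite !inE => xk yl i _; rewrite /B /Bx /By/=.
    by split; case: eqVneq => // ->.
  move=> h; apply/andP; rewrite !inE; split.
    by have [] := h _ kj; rewrite /Bx eqxx.
  by have [_] := h _ lj; rewrite /By eqxx.
rewrite (expectation_prod_cylinders P_prod (fun j => [seq (k, l) | k <- I j,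
  l <- I j]) blk_le c0 mB) -prodEFin.
apply: lee_prod => j; apply/andP; split.
  by apply: sume_ge0 => kl _; rewrite mule_ge0 ?lee_fin ?prode_ge0.
rewrite big_allpairs.
have muBx k : mu (Bx k k) = (ballm mu (rho k) x)%:E by rewrite /Bx eqxx ballmE.
have muBy k : mu (By k k) = (ballm mu (rho k) y)%:E by rewrite /By eqxx ballmE.
(* The off-diagonal terms are completed to the full double sum of products of coefficients, which is
   1. *)
apply: (@le_trans _ _ (\sum_(blk j <= k < blk j.+1) (coef j k * \sum_(blk j <= l < blk j.+1) coef j l
   + coef j k ^+ 2 * pair_density mu F (rho k) x y)%:E)%E); last first.
  by rewrite sumEFin lee_fin big_split/= -mulr_suml !sum_coef mulr1.
rewrite big_seq [leRHS]big_seq; apply: lee_sum => k; rewrite mem_index_iota =>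
  /[dup] kj /andP[k1 k2].
have rk := rho01_blk k1.
rewrite (bigD1_seq k) ?mem_index_iota ?iota_uniq//= addeC EFinD leeD//.
  apply: (@le_trans _ _ (\sum_(blk j <= l < blk j.+1 | l != k) (coef j k * coef j l)%:E)%E).
    rewrite big_seq_cond [leRHS]big_seq_cond; apply: lee_sum => l; rewrite mem_index_iota =>
      /andP[/[dup] lj /andP[l1 l2] lk].
    rewrite (bigD1_seq k) ?mem_index_iota ?iota_uniq//=.
    rewrite -big_filter (bigD1_seq l) ?mem_filter ?lk ?mem_index_iota ?filter_uniq ?iota_uniq//=.
    rewrite big1_seq ?mule1; last first.
      move=> i; rewrite mem_filter => /andP[il /andP[ik _]];
        rewrite /B /Bx /By/= (negbTE ik) (negbTE il) setIT.
      exact: probability_setT.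
    rewrite {1}/B {1}/By/= eq_sym (negbTE lk) setIT muBx.
    rewrite {1}/B {1}/Bx/= (negbTE lk) setTI muBy -!EFinM lee_fin /c/=.
    rewrite [leLHS](_ : _ = coef j k * coef j l *
      ((density mu F (rho k) x * ballm mu (rho k) x) * (density mu F (rho l) y * ballm mu (rho l) y))); last by ring.
    rewrite !(densityM_ballm A0 ball_lower) ?(rho01_blk k1) ?(rho01_blk l1)//.
    by rewrite !indicE !mem_set// !mulr1.
  rewrite sumEFin lee_fin mulr_sumr [leRHS](bigD1_seq k) ?mem_index_iota ?iota_uniq//=.
  by rewrite lerDr; apply: mulr_ge0; exact: coef_ge0.
rewrite (bigD1_seq k) ?mem_index_iota ?iota_uniq//= big1 ?mule1; last first.
  move=> i ik; rewrite /B /Bx /By/= (negbTE ik) setIT; exact: probability_setT.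
rewrite /B /Bx /By/= eqxx -eballI_measureE -EFinM lee_fin /c/= /pair_density.
by rewrite le_eqVlt; apply/orP; left; apply/eqP; ring.
Qed.

End cascade.

(** * Mass, energy and covers *)

(** Applied with [kap = 1] to compare squared mass and energy of the cascade, and with
    [kap = tau ^+ m] to the part of a density on a set of small diameter. *)
Lemma riesz_energy_ge (R : realType) (d : nat) (mu : probability (borelRd R d) R)
    (tau kap : R) (f : borelRd R d -> R) :
  0 <= tau -> 0 <= kap -> measurable_fun setT f -> (forall x, 0 <= f x) ->
  (forall x y, f x != 0 -> f y != 0 -> (kap%:E <= riesz tau x y)%E) ->
  (kap%:E * (\int[mu]_x (f x)%:E * \int[mu]_x (f x)%:E) <=
   \int[mu \x mu]_p (riesz tau p.1 p.2 * (f p.1 * f p.2)%:E))%E.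
Proof.
move=> tau0 kap0 mf f0 hk.
have mff : measurable_fun setT (fun p : borelRd R d * borelRd R d => (f p.1 * f p.2)%:E).
  by apply/measurable_EFinP; apply: measurable_funM;
    [exact: (measurableT_comp mf measurable_fst)|exact: (measurableT_comp mf measurable_snd)].
have ff0 p : (0 <= (f p.1 * f p.2 : R)%:E)%E by rewrite lee_fin mulr_ge0.
have If0 : (0 <= \int[mu]_x (f x)%:E)%E by apply: integral_ge0 => x _; rewrite lee_fin.
have mEf : measurable_fun setT (fun x => (f x)%:E) by exact/measurable_EFinP.
have <- : (\int[mu \x mu]_p (f p.1 * f p.2)%:E = \int[mu]_x (f x)%:E * \int[mu]_x (f x)%:E)%E.
  rewrite (fubini_tonelli1 _ mff ff0) /fubini_F/=.
  under eq_integral => x _.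
    under eq_integral do rewrite EFinM.
    rewrite ge0_integralZl_EFin//; last by move=> y _; rewrite lee_fin.
    over.
  rewrite ge0_integralZr//.
  by move=> x _; rewrite lee_fin.
rewrite -ge0_integralZl_EFin//.
apply: ge0_le_integral => //.
- by move=> p _; rewrite mule_ge0// lee_fin.
- exact: measurable_funeM.
- apply: emeasurable_funM => //; apply: measurable_riesz => //.
move=> p _.
have [->|fx] := eqVneq (f p.1) 0; first by rewrite mul0r !mule0.
have [->|fy] := eqVneq (f p.2) 0; first by rewrite mulr0 !mule0.
by rewrite lee_wpmul2r// hk.
Qed.

(* Induction on q splits off the part of f living on the last set of the cover; on a set
   where the kernel is at least k, u <= lam / k + k u^2 / lam bounds its mass u. *)
Lemma mass_le_cover_energy (R : realType) (d : nat) (mu : probability (borelRd R d) R)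
    (tau lam : R) (V : nat -> set (borelRd R d)) (m : nat -> nat) (q : nat)
    (f : borelRd R d -> R) :
  0 < tau -> 0 < lam -> (forall i, measurable (V i)) ->
  (forall i x y, V i x -> V i y -> eball x (2 / 2 ^+ m i) y) ->
  measurable_fun setT f -> (forall x, 0 <= f x) ->
  (forall x, f x != 0 -> exists2 i, (i < q)%N & V i x) ->
  (\int[mu]_x (f x)%:E <= (lam * \sum_(i < q) tau ^- m i)%:E +
   (lam^-1)%:E * \int[mu \x mu]_p (riesz tau p.1 p.2 * (f p.1 * f p.2)%:E))%E.
Proof.
move=> tau0 lam0 mV hV; elim: q f => [|q IH] f mf f0 hf.
  rewrite integral0_eq; last first.
    by move=> x _; have [->//|/hf[]] := eqVneq (f x) 0.
  rewrite big_ord0 mulr0 add0e; apply: mule_ge0; first by rewrite lee_fin invr_ge0 ltW.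
  by apply: integral_ge0 => p _; rewrite mule_ge0 ?riesz_ge0 ?lee_fin ?mulr_ge0// ltW.
pose f1 x := f x * \1_(V q) x; pose f2 x := f x * \1_(~` V q) x.
have mf1 : measurable_fun setT f1 by apply: measurable_funM => //; exact: measurable_indic.
have mf2 : measurable_fun setT f2.
  by apply: measurable_funM => //; apply: measurable_indic; exact: measurableC.
have f10 x : 0 <= f1 x by rewrite mulr_ge0.
have f20 x : 0 <= f2 x by rewrite mulr_ge0.
have ffD x : f x = f1 x + f2 x.
  rewrite /f1 /f2 -mulrDr !indicE in_setC.
  by case: (x \in V q); rewrite /= ?addr0 ?add0r mulr1.
have eE (g : borelRd R d -> R) : measurable_fun setT g -> (forall x, 0 <= g x) ->
    measurable_fun setT (fun p : borelRd R d * borelRd R d =>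
      riesz tau p.1 p.2 * (g p.1 * g p.2 : R)%:E)%E /\
    (forall p : borelRd R d * borelRd R d, 0 <= riesz tau p.1 p.2 * (g p.1 * g p.2 : R)%:E)%E.
  move=> mg g0; split.
    apply: emeasurable_funM => //; first by apply: measurable_riesz => //; exact: ltW.
    by apply/measurable_EFinP; apply: measurable_funM;
      [exact: (measurableT_comp mg measurable_fst)|exact: (measurableT_comp mg measurable_snd)].
  by move=> p; rewrite mule_ge0 ?riesz_ge0 ?lee_fin ?mulr_ge0// ltW.
have [m1 e10] := eE _ mf1 f10; have [m2 e20] := eE _ mf2 f20; have [mm e0] := eE _ mf f0.
pose e g := (\int[mu \x mu]_p (riesz tau p.1 p.2 * (g p.1 * g p.2)%:E))%E.
(* The cross terms of the energy are nonnegative and are dropped. *)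
have eD : (e f1 + e f2 <= e f)%E.
  rewrite /e -ge0_integralD//; apply: ge0_le_integral => //.
  - by move=> p _; rewrite adde_ge0.
  - exact: emeasurable_funD.
  move=> p _; rewrite -ge0_muleDr ?lee_fin ?mulr_ge0//.
  apply: lee_wpmul2l; first by rewrite riesz_ge0 ?ltW.
  rewrite -EFinD lee_fin !ffD mulrDl !mulrDr -addrA lerD2l addrCA addrA lerDr.
  by rewrite addr_ge0// mulr_ge0.
have h2 := IH f2 mf2 f20.
have h1 : (\int[mu]_x (f1 x)%:E <= (lam * tau ^- m q)%:E + (lam^-1)%:E * e f1)%E.
  have kap0 : 0 < tau ^+ m q by rewrite exprn_gt0.
  have := @riesz_energy_ge R d mu tau (tau ^+ m q) f1 (ltW tau0) (ltW kap0) mf1 f10.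
  have : forall x y, f1 x != 0 -> f1 y != 0 -> ((tau ^+ m q)%:E <= riesz tau x y)%E.
    move=> x y; rewrite /f1 !indicE.
    have [xV|xV] := boolP (x \in V q); last by rewrite mulr0 eqxx.
    have [yV|yV] := boolP (y \in V q); last by rewrite mulr0 eqxx.
    move=> _ _; apply: riesz_ge; first exact: ltW.
    by apply: hV (set_mem _) (set_mem _).
  move=> hk /(_ hk); rewrite -/(e f1).
  have : (0 <= \int[mu]_x (f1 x)%:E)%E by apply: integral_ge0 => x _; rewrite lee_fin.
  case: (\int[mu]_x (f1 x)%:E)%E => [u|_|//].
    rewrite lee_fin => u0.
    have : (0 <= e f1)%E by apply: integral_ge0.
    case: (e f1) => [v|_ _|//]; last by rewrite gt0_muley ?lte_fin ?invr_gt0// leey.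
    rewrite !lee_fin => v0 huv.
    rewrite -subr_ge0.
    have -> : lam / tau ^+ m q + lam^-1 * v - u =
       lam^-1 * ((tau ^+ m q)^-1 * (lam - tau ^+ m q * u / 2) ^+ 2 + (v - tau ^+ m q * (u * u)) +
          3 / 4 * (tau ^+ m q * (u * u))).
      by field; rewrite !gt_eqF.
    apply: mulr_ge0; first by rewrite invr_ge0 ltW.
    apply: addr_ge0; last by rewrite mulr_ge0 ?divr_ge0// mulr_ge0 ?(ltW kap0)// mulr_ge0.
    apply: addr_ge0; last by rewrite subr_ge0.
    by rewrite mulr_ge0 ?sqr_ge0// invr_ge0 ltW.
  rewrite gt0_muley ?lte_fin// leye_eq => /eqP ->.
  by rewrite gt0_muley ?lte_fin ?invr_gt0// leey.
have -> : (\int[mu]_x (f x)%:E = \int[mu]_x (f1 x)%:E + \int[mu]_x (f2 x)%:E)%E.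
  rewrite -ge0_integralD//; last 4 first.
  - by move=> x _; rewrite lee_fin.
  - exact/measurable_EFinP.
  - by move=> x _; rewrite lee_fin.
  - exact/measurable_EFinP.
  by apply: eq_integral => x _; rewrite ffD.
apply: (@le_trans _ _ ((lam * tau ^- m q)%:E + (lam^-1)%:E * e f1 +
   ((lam * \sum_(i < q) tau ^- m i)%:E + (lam^-1)%:E * e f2))%E).
  apply: leeD => //; apply: h2 => x; rewrite /f2 indicE in_setC.
  have [xV|xV] := boolP (x \in V q); first by rewrite mulr0 eqxx.
  rewrite mulr1 => /hf[i iq Vi]; exists i => //.
  move: iq; rewrite ltnS leq_eqVlt => /predU1P[iq|//].
  by rewrite notin_setE in xV; rewrite iq in Vi.
rewrite addeACA -EFinD -mulrDr big_ord_recr/= [(_ ^- m q + _)%R]addrC.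
rewrite -ge0_muleDr; [|exact: integral_ge0|exact: integral_ge0].
by rewrite leeD2l// lee_wpmul2l// lee_fin invr_ge0 ltW.
Qed.

(** * Energy bounds for the cascade *)

Section energy.
Context {R : realType} {d : nat} (mu : probability (borelRd R d) R)
  (P : probability (seqRd R d) R).
Hypothesis P_prod : is_product_measure mu P.
Local Notation T := (borelRd R d).
Local Notation W := (seqRd R d).
Context (F : set T) (A b : R).
Hypotheses (mF : measurable F) (A0 : 0 < A).
Hypothesis ball_lower : forall x, F x -> forall e, 0 < e <= 1 -> e `^ b <= A * ballm mu e x.
Context (rho : nat -> R) (s t : R) (blk : nat -> nat).
Hypothesis rho01 : forall k, (blk 0 <= k)%N -> 0 < rho k <= 1.
Hypothesis blk_le : forall j, (blk j <= blk j.+1)%N.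
Hypothesis block_sum_gt0 : forall j, 0 < block_sum rho s blk j.
Context (C0 C1 : R).
Hypothesis riesz_le : forall x, F x -> (\int[mu]_y riesz (2 `^ t) x y <= C0%:E)%E.
Hypothesis riesz_pair_le : forall e x, 0 < e <= 1 ->
    (\int[mu]_y (riesz (2 `^ t) x y * (pair_density mu F e x y)%:E) <= (C1 * e `^ (- s))%:E)%E.

(** A deterministic bound for the product of the factors [1 + correlation] of the earlier blocks. It
    involves only indices before the next block, so that block can afterwards be chosen long enough
    for [growth]. *)
Definition correlation_bound (m0 m : nat) : R := \prod_(m0 <= k < m) (1 + A * rho k `^ (- b)).

Hypothesis growth : forall j,
  C1 * correlation_bound (blk 0) (blk j) * 2 ^+ j.+1 <= block_sum rho s blk j.

Local Notation cascade := (cascade mu F rho s blk).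
Local Notation correlation := (correlation mu F rho s blk).
Local Notation coef := (coef rho s blk).

Let tau0 : 0 <= 2 `^ t :> R. Proof. exact: powR_ge0. Qed.

Lemma prod_correlation_le n x y :
  \prod_(j < n) (1 + correlation j x y) <= correlation_bound (blk 0) (blk n).
Proof.
have term0 k : 0 <= A * rho k `^ (- b) by rewrite mulr_ge0 ?powR_ge0// ltW.
elim: n => [|n IH]; first by rewrite big_ord0 /correlation_bound big_geq.
rewrite big_ord_recr/= /correlation_bound.
rewrite (big_cat_nat (blk_ge0 blk_le n) (blk_le n))/=.
apply: ler_pM => //.
- by apply: prodr_ge0 => j _; apply: addr_ge0 => //; exact: correlation_ge0.
- by apply: addr_ge0 => //; exact: correlation_ge0.
apply: (@le_trans _ _ (1 + \sum_(blk n <= k < blk n.+1) A * rho k `^ (- b))).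
  rewrite lerD2l /correlation big_nat [leRHS]big_nat; apply: ler_sum => k /[dup] kn /andP[k1 k2].
  have r1 := rho01_blk rho01 blk_le k1.
  apply: (@le_trans _ _ (pair_density mu F (rho k) x y)).
    rewrite ler_piMl ?pair_density_ge0// expr_le1//.
      exact: coef_le1.
    exact: coef_ge0.
  by rewrite (le_trans (pair_density_le A0 ball_lower _ _ _))// (density_le A0 ball_lower).
(* One plus a sum of nonnegative terms is at most the product of the one plus each term. *)
elim: (index_iota _ _) => [|k l IHl]; first by rewrite !big_nil addr0.
rewrite !big_cons.
have l0 : 0 <= \sum_(i <- l) A * rho i `^ (- b) by rewrite sumr_ge0.
have := term0 k; set u := A * _ => u0.
apply: (@le_trans _ _ ((1 + u) * (1 + \sum_(i <- l) A * rho i `^ (- b)))); first by nra.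
by rewrite ler_wpM2l// addr_ge0.
Qed.

(** One factor of [coef j k ^+ 2] cancels rho_k^(-s) and leaves the inverse of the block sum; the
    remaining factors [coef j k] add up to 1. *)
Lemma integral_riesz_correlation_le j x :
  (\int[mu]_y (riesz (2 `^ t) x y * (correlation j x y)%:E) <= (C1 / block_sum rho s blk j)%:E)%E.
Proof.
have mr : measurable_fun [set: T] (riesz (2 `^ t) x).
  exact: (measurable_riesz tau0 (measurable_cst x) (@measurable_id _ T setT)).
have mp k : measurable_fun [set: T] (fun y => (pair_density mu F (rho k) x y)%:E).
  by apply/measurable_EFinP;
    exact: (measurable_pair_density mu mF _ (measurable_cst x) (@measurable_id _ T setT)).
have r0 y : (0 <= riesz (2 `^ t) x y)%E by exact: riesz_ge0.
rewrite (_ : (fun y => _) = (fun y => \sum_(blk j <= k < blk j.+1)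
   ((coef j k ^+ 2)%:E * (riesz (2 `^ t) x y * (pair_density mu F (rho k) x y)%:E)))%E); last first.
  apply/funext => y; rewrite /correlation -sumEFin ge0_sume_distrr; last first.
    move=> k _; rewrite lee_fin; apply: mulr_ge0; first exact: sqr_ge0.
    exact: pair_density_ge0.
  by apply: eq_bigr => k _; rewrite EFinM muleCA.
rewrite ge0_integral_sum//; last 2 first.
- by move=> k; apply: measurable_funeM; exact: emeasurable_funM.
- move=> k y _; rewrite mule_ge0// ?lee_fin ?sqr_ge0// mule_ge0// lee_fin.
  exact: pair_density_ge0.
apply: (@le_trans _ _ (\sum_(blk j <= k < blk j.+1) (C1 / block_sum rho s blk j * coef j k)%:E)%E).
  rewrite big_nat [leRHS]big_nat; apply: lee_sum => k /[dup] kn /andP[k1 k2].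
  have r1 := rho01_blk rho01 blk_le k1; have /andP[rk0 _] := r1.
  rewrite ge0_integralZl_EFin//; last 3 first.
  - by move=> y _; rewrite mule_ge0// lee_fin; exact: pair_density_ge0.
  - exact: emeasurable_funM.
  - exact: sqr_ge0.
  apply: (@le_trans _ _ ((coef j k ^+ 2)%:E * (C1 * rho k `^ (- s))%:E)%E).
    by rewrite lee_wpmul2l ?lee_fin ?sqr_ge0// riesz_pair_le.
  rewrite -EFinM lee_fin le_eqVlt; apply/orP; left; apply/eqP.
  rewrite /coef powRN; field.
  by rewrite !gt_eqF ?powR_gt0.
by rewrite sumEFin -mulr_sumr sum_coef// mulr1.
Qed.

(** Induction on [n] with the sharper bound C0 + 1 - 2^(-n). In the term added by block [n] the
    earlier factors are replaced by the constant [correlation_bound], and [growth] makes this term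
    at most 2^(-n-1). *)
Lemma integral_riesz_prod_correlation_le n x : F x ->
  (\int[mu]_y (riesz (2 `^ t) x y * (\prod_(j < n) (1 + correlation j x y))%:E) <= (C0 + 1)%:E)%E.
Proof.
have half (u : R) : 1 - u + 2^-1 * u <= 1 - 2^-1 * u by lra.
move=> Fx.
have mr : measurable_fun [set: T] (riesz (2 `^ t) x).
  exact: (measurable_riesz tau0 (measurable_cst x) (@measurable_id _ T setT)).
have mc j : measurable_fun [set: T] (correlation j x).
  exact: (measurable_correlation mu mF _ _ _ _ (measurable_cst x) (@measurable_id _ T setT)).
have mp n' : measurable_fun [set: T] (fun y => \prod_(j < n') (1 + correlation j x y)).
  by apply: measurable_prod => j _; exact: measurable_funD.
have r0 y : (0 <= riesz (2 `^ t) x y)%E by exact: riesz_ge0.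
have c0 j y : 0 <= correlation j x y by exact: correlation_ge0.
have p0 n' y : 0 <= \prod_(j < n') (1 + correlation j x y).
  by rewrite prodr_ge0// => j _; rewrite addr_ge0.
suff : (\int[mu]_y (riesz (2 `^ t) x y * (\prod_(j < n) (1 + correlation j x y))%:E) <=
   (C0 + (1 - 2 ^- n))%:E)%E.
  by move=> h; rewrite (le_trans h)// lee_fin lerD2l gerBl invr_ge0 exprn_ge0.
elim: n => [|n IH].
  under eq_integral do rewrite big_ord0 mule1.
  by rewrite expr0 invr1 subrr addr0 riesz_le.
apply: (@le_trans _ _ (\int[mu]_y (riesz (2 `^ t) x y * (\prod_(j < n) (1 + correlation j x y))%:E
   + (correlation_bound (blk 0) (blk n))%:E * (riesz (2 `^ t) x y * (correlation n x y)%:E))%E)%E).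
  have mb : measurable_fun [set: T] (fun y => (correlation_bound (blk 0) (blk n))%:E *
      (riesz (2 `^ t) x y * (correlation n x y)%:E))%E.
    by apply: measurable_funeM; apply: emeasurable_funM => //; exact/measurable_EFinP.
  apply: ge0_le_integral => //.
  - by move=> y _; rewrite mule_ge0// lee_fin.
  - by apply: emeasurable_funM => //; exact/measurable_EFinP.
  - by apply: emeasurable_funD => //; apply: emeasurable_funM => //; exact/measurable_EFinP.
  move=> y _; rewrite big_ord_recr/= mulrDr mulr1 EFinD ge0_muleDr ?lee_fin ?mulr_ge0//.
  rewrite leeD2l// EFinM muleCA lee_wpmul2r ?mule_ge0 ?lee_fin//.
  - exact: prod_correlation_le.
  - exact: p0.
  - exact: p0.
have B0 : 0 <= correlation_bound (blk 0) (blk n).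
  by rewrite (le_trans (p0 n x))// prod_correlation_le.
have rc0 y : (0 <= riesz (2 `^ t) x y * (correlation n x y)%:E)%E by rewrite mule_ge0 ?lee_fin.
have mrc : measurable_fun [set: T] (fun y => riesz (2 `^ t) x y * (correlation n x y)%:E)%E.
  by apply: emeasurable_funM => //; exact/measurable_EFinP.
rewrite ge0_integralD//; last 4 first.
- by move=> y _; rewrite mule_ge0// lee_fin.
- by apply: emeasurable_funM => //; exact/measurable_EFinP.
- by move=> y _; rewrite mule_ge0// lee_fin.
- exact: measurable_funeM.
rewrite ge0_integralZl_EFin//.
apply: (@le_trans _ _ ((C0 + (1 - 2 ^- n))%:E + (2 ^- n.+1)%:E)%E); last first.
  rewrite -EFinD lee_fin -addrA lerD2l exprS invfM.
  exact: half.
rewrite leeD//.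
apply: (@le_trans _ _ ((correlation_bound (blk 0) (blk n))%:E * (C1 / block_sum rho s blk n)%:E)%E).
  by rewrite lee_wpmul2l ?lee_fin// integral_riesz_correlation_le.
rewrite -EFinM lee_fin mulrA ler_pdivrMr// mulrC [leRHS]mulrC ler_pdivlMr ?exprn_gt0//.
Qed.

Definition cascade_mass n (w : W) : \bar R := (\int[mu]_x (cascade n x w)%:E)%E.

Definition cascade_energy n (w : W) : \bar R :=
  (\int[mu \x mu]_p (riesz (2 `^ t) p.1 p.2 * (cascade n p.1 w * cascade n p.2 w)%:E))%E.

Let cas0 n x w : 0 <= cascade n x w.
Proof. exact: cascade_ge0. Qed.

Let mcas n d' (S : measurableType d') (f : S -> T) (g : S -> W) :
  measurable_fun setT f -> measurable_fun setT g ->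
  measurable_fun setT (fun p => cascade n (f p) (g p)).
Proof. exact: measurable_cascade. Qed.

Let h1 n (p : W * T) := (cascade n p.2 p.1)%:E.
Let mh1 n : measurable_fun setT (h1 n).
Proof. by apply/measurable_EFinP; exact: mcas. Qed.

Let h2 n (p : W * (T * T)) := (riesz (2 `^ t) p.2.1 p.2.2 * (cascade n p.2.1 p.1 * cascade n p.2.2 p.1)%:E)%E.
Let mh2 n : measurable_fun setT (h2 n).
Proof.
have m1 : measurable_fun setT (fun p : W * (T * T) => p.2.1).
  exact: (measurableT_comp measurable_fst measurable_snd).
have m2 : measurable_fun setT (fun p : W * (T * T) => p.2.2).
  exact: (measurableT_comp measurable_snd measurable_snd).
apply: emeasurable_funM; first exact: measurable_riesz.
by apply/measurable_EFinP; apply: measurable_funM; exact: mcas.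
Qed.

(** The square of [mu] typed as a sigma-finite measure, as Tonelli against [P] requires. *)
Let mm : {sigma_finite_measure set (T * T)%type -> \bar R} :=
  product_subprobability (mu : subprobability T R, mu : subprobability T R).

Lemma measurable_cascade_mass n : measurable_fun setT (cascade_mass n).
Proof. by apply: (measurable_fun_fubini_tonelli_F (h1 n)) => // p; rewrite lee_fin. Qed.

Lemma measurable_cascade_energy n : measurable_fun setT (cascade_energy n).
Proof.
have h20 p : (0 <= h2 n p)%E by rewrite mule_ge0 ?riesz_ge0// lee_fin mulr_ge0.
exact: (@measurable_fun_fubini_tonelli_F _ _ _ _ _ mm (h2 n) (mh2 n) h20).
Qed.

Lemma expectation_cascade_mass n : (\int[P]_w cascade_mass n w = mu F)%E.
Proof.
rewrite (fubini_tonelli (h1 n)) => //; last by move=> p; rewrite lee_fin.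
transitivity (\int[mu]_x (\1_F x)%:E)%E; last by rewrite integral_indic// setIT.
apply: eq_integral => x _.
have [Fx|Fx] := pselect (F x).
  rewrite indicE mem_set//; exact: (expectation_cascade P_prod A0 ball_lower).
rewrite indicE memNset// integral0_eq// => w _.
by rewrite /h1/= cascade_notin.
Qed.

(** Tonelli moves the expectation inside, where [expectation_cascadeM_le] applies on pairs in [F].
    It remains to integrate over [x] in [F] the bound on the potential of the product of the
    [1 + correlation]. *)
Lemma expectation_cascade_energy_le n : 0 <= C0 ->
  (\int[P]_w cascade_energy n w <= (C0 + 1)%:E)%E.
Proof.
move=> C00.
have h20 p : (0 <= h2 n p)%E by rewrite mule_ge0 ?riesz_ge0// lee_fin mulr_ge0.
rewrite [leLHS](@fubini_tonelli _ _ _ _ _ P mm (h2 n) (mh2 n) h20).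
pose k (p : T * T) := ((\1_F p.1)%:E * (riesz (2 `^ t) p.1 p.2 * (\prod_(j < n) (1 + correlation j p.1 p.2))%:E))%E.
have mk : measurable_fun setT k.
  apply: emeasurable_funM.
    by apply/measurable_EFinP; apply: (measurableT_comp _ measurable_fst); exact: measurable_indic.
  apply: emeasurable_funM.
    by apply: measurable_riesz.
  apply/measurable_EFinP; apply: measurable_prod => j _; apply: measurable_funD => //.
  exact: measurable_correlation.
have p0 x y : 0 <= \prod_(j < n) (1 + correlation j x y).
  by apply: prodr_ge0 => j _; apply: addr_ge0 => //; exact: correlation_ge0.
have k0 p : (0 <= k p)%E.
  apply: mule_ge0; first by rewrite lee_fin.
  by apply: mule_ge0; [exact: riesz_ge0|rewrite lee_fin].
apply: (@le_trans _ _ (\int[mu \x mu]_p k p)%E).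
  apply: ge0_le_integral => //.
  - by move=> p _; apply: integral_ge0 => w _; exact: h20.
  - exact: (measurable_fun_fubini_tonelli_G (h2 n)).
  move=> p _; rewrite /h2/=.
  have [Fx|Fx] := pselect (F p.1); last first.
    rewrite integral0_eq ?k0// => w _.
    by rewrite (cascade_notin _ _ _ _ _ _ Fx) mul0r mule0.
  have [Fy|Fy] := pselect (F p.2); last first.
    rewrite integral0_eq ?k0// => w _.
    by rewrite (cascade_notin _ _ _ _ _ _ Fy) mulr0 mule0.
  rewrite ge0_integralZl//; last 3 first.
  - apply/measurable_EFinP; apply: measurable_funM.
      exact: (mcas n (measurable_cst p.1) (@measurable_id _ W setT)).
    exact: (mcas n (measurable_cst p.2) (@measurable_id _ W setT)).
  - by move=> w _; rewrite lee_fin mulr_ge0.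
  - exact: riesz_ge0.
  rewrite /k indicE mem_set// mul1e lee_wpmul2l ?riesz_ge0//.
  exact: (expectation_cascadeM_le P_prod A0 ball_lower).
rewrite (fubini_tonelli1 _ mk k0) /fubini_F/=.
apply: (@le_trans _ _ (\int[mu]_x (C0 + 1)%:E)%E); last first.
  by rewrite integral_cst// -[leRHS]mule1 lee_wpmul2l ?probability_le1// lee_fin addr_ge0.
apply: ge0_le_integral => //.
- by move=> x _; apply: integral_ge0 => y _; exact: k0.
- exact: (measurable_fun_fubini_tonelli_F k).
move=> x _; rewrite /k/=; have [Fx|Fx] := pselect (F x); last first.
  under eq_integral do rewrite indicE memNset// mul0e.
  by rewrite integral0 lee_fin addr_ge0.
under eq_integral do rewrite indicE mem_set// mul1e.
exact: integral_riesz_prod_correlation_le.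
Qed.

Lemma cascade_mass_ge0 n w : (0 <= cascade_mass n w)%E.
Proof. by apply: integral_ge0 => x _; rewrite lee_fin. Qed.

Lemma cascade_massM_le n w : (cascade_mass n w * cascade_mass n w <= cascade_energy n w)%E.
Proof.
rewrite -[leLHS]mul1e; apply: riesz_energy_ge => //.
  exact: (mcas n (@measurable_id _ T setT) (measurable_cst w)).
by move=> x y _ _; exact: riesz_ge1.
Qed.

End energy.

(** * A second moment argument *)

(* Pointwise [X <= lam 1_A + m / 2 + Y / lam] with [A] the event below, so that
   integrating bounds the probability of [A] from below uniformly in [n]. *)
Lemma moments_infinitely_often (R : realType) d (W : measurableType d) (P : probability W R)
    (X Y : nat -> W -> \bar R) (m C : R) (Q : W -> Prop) :
  0 < m -> 0 < C ->
  (forall n, measurable_fun setT (X n)) -> (forall n, measurable_fun setT (Y n)) ->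
  (forall n w, 0 <= X n w)%E -> (forall n w, X n w * X n w <= Y n w)%E ->
  (forall n, \int[P]_w X n w = m%:E)%E -> (forall n, \int[P]_w Y n w <= C%:E)%E ->
  (\forall w \ae P, Q w) ->
  exists2 w, Q w & forall n, exists k, [/\ (n <= k)%N, ((m / 2)%:E <= X k w)%E &
     (Y k w <= ((4 * C / m) ^+ 2)%:E)%E].
Proof.
move=> m0 C0 mX mY X0 XY EX EY hQ.
(* With this value C / lam = m / 4, so of the mean [m] at least m / 4 is left for
   [lam * P (A n)]. *)
pose lam := 4 * C / m.
have lam0 : 0 < lam by rewrite divr_gt0// mulr_gt0.
pose A n := [set w | (m / 2)%:E <= X n w]%E `&` [set w | Y n w <= (lam ^+ 2)%:E]%E.
have mA n : measurable (A n).
  apply: measurableI; rewrite -[X in measurable X]setTI.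
    exact: emeasurable_fun_c_infty.
  exact: emeasurable_fun_infty_c.
have Y0 n w : (0 <= Y n w)%E by rewrite (le_trans _ (XY n w))// mule_ge0.
have PA n : ((m / (4 * lam))%:E <= P (A n))%E.
  have : (m%:E <= \int[P]_w ((lam * \1_(A n) w)%:E + ((m / 2)%:E + (lam^-1)%:E * Y n w)))%E.
    rewrite -(EX n); apply: ge0_le_integral => //.
    - apply: emeasurable_funD.
        by apply/measurable_EFinP; apply: measurable_funM => //; exact: measurable_indic.
      by apply: emeasurable_funD => //; exact: measurable_funeM.
    move=> w _; have := Y0 n w; have := XY n w; have := X0 n w.
    have [/[dup] Aw [Aw1 Aw2]|Aw] := pselect (A n w).
      rewrite indicE mem_set// mulr1; move: Aw2 => /=.
      case: (Y n w) => [v| |]//; rewrite ?leye_eq//.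
      case: (X n w) => [u| |]//; rewrite ?gt0_muley//.
      rewrite -!EFinM -!EFinD !lee_fin => v1 u0 uv v0.
      have ul : u <= lam.
        by rewrite -(@ler_pXn2r _ 2)// ?nnegrE// ?(ltW lam0)// expr2 (le_trans uv).
      by rewrite (le_trans ul)// lerDl addr_ge0 ?mulr_ge0// ?invr_ge0 ltW// divr_gt0.
    rewrite indicE memNset// mulr0 add0e.
    have {Aw} : ~ (((m / 2)%:E <= X n w)%E /\ (Y n w <= (lam ^+ 2)%:E)%E) by exact: Aw.
    case: (Y n w) => [v| |] //; last first.
      by move=> _ _ _ _; rewrite gt0_muley ?lte_fin ?invr_gt0// addey// leey.
    case: (X n w) => [u| |]//.
    rewrite -!EFinM -!EFinD !lee_fin => nA u0 uv v0.
    have [um|mu] := ltP u (m / 2).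
      by rewrite (le_trans (ltW um))// lerDl mulr_ge0// invr_ge0 ltW.
    have vl : lam ^+ 2 < v.
      by rewrite ltNge; apply/negP => vl; exact: nA.
    apply: (@le_trans _ _ (lam^-1 * v)); last by rewrite lerDr divr_ge0// ltW.
    (* lam u <= v follows from lam^2 < v when u <= lam, and from u^2 <= v otherwise. *)
    rewrite ler_pdivlMl//; have [ul|lu] := leP u lam.
      by rewrite (le_trans _ (ltW vl))// expr2 ler_wpM2l// ltW.
    by rewrite (le_trans _ uv)// ler_wpM2r// ltW.
  rewrite ge0_integralD//; last 4 first.
  - by move=> w _; rewrite lee_fin mulr_ge0// ltW.
  - by apply/measurable_EFinP; apply: measurable_funM => //; exact: measurable_indic.
  - by move=> w _; rewrite adde_ge0 ?lee_fin ?divr_ge0 ?(ltW m0)// mule_ge0// lee_fin invr_ge0 ltW.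
  - by apply: emeasurable_funD => //; exact: measurable_funeM.
  rewrite ge0_integralD//; last 3 first.
  - by move=> w _; rewrite lee_fin divr_ge0// ltW.
  - by move=> w _; rewrite mule_ge0// lee_fin invr_ge0 ltW.
  - exact: measurable_funeM.
  rewrite ge0_integralZl_EFin//; last by rewrite invr_ge0 ltW.
  under eq_integral do rewrite EFinM.
  rewrite ge0_integralZl_EFin//; last 2 first.
  - by apply/measurable_EFinP; exact: measurable_indic.
  - exact: ltW.
  rewrite integral_indic// setIT.
  have -> : (\int[P]_w (m / 2)%:E = (m / 2)%:E)%E.
    by rewrite integral_cst// -[RHS]mule1; congr (_ * _)%E; exact: probability_setT.
  have Pfin : P (A n) \is a fin_num by rewrite fin_num_measure.
  rewrite -(fineK Pfin) => hm.
  have {hm}: (m%:E <= (lam * fine (P (A n)) + (m / 2 + lam^-1 * C))%:E)%E.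
    rewrite [leRHS](_ : _ = lam%:E * (fine (P (A n)))%:E + ((m / 2)%:E + (lam^-1)%:E * C%:E))%E//.
    by rewrite (le_trans hm)// leeD// ?(fineK Pfin)// leeD// lee_wpmul2l// lee_fin invr_ge0 ltW.
  rewrite !lee_fin ler_pdivrMr; last exact: mulr_gt0.
  have -> : lam^-1 * C = m / 4 by rewrite /lam; field; rewrite !gt_eqF.
  move: (fine (P (A n))) => pr; lra.
have mS : measurable (lim_sup_set A).
  by apply: bigcapT_measurable => n; apply: bigcup_measurable => k _; exact: mA.
(* The tail unions all have at least this probability, and their probabilities converge to that of
   the limsup event. *)
have PS : ((m / (4 * lam))%:E <= P (lim_sup_set A))%E.
  have h := @lim_sup_set_cvg _ W R P A mA.
  have hfin : (P (\bigcup_(k >= 0) A k) < +oo)%E.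
    by rewrite ltey_eq fin_num_measure// ; apply: bigcup_measurable.
  apply: (cvge_ge _ (h hfin)); apply: nearW => n.
  rewrite (le_trans (PA n))// le_measure ?inE//.
    by apply: bigcup_measurable.
  by move=> w Aw; exists n => /=.
have [N [mN N0 hN]] := hQ.
have : ~ (lim_sup_set A `<=` N).
  move=> AN; have : (P (lim_sup_set A) <= P N)%E by rewrite le_measure ?inE.
  rewrite N0 => /(le_trans PS); rewrite lee_fin leNgt => /negP; apply.
  by rewrite divr_gt0// mulr_gt0.
move=> /existsNP[w /not_implyP[Aw Nw]]; exists w.
  by apply: contrapT => nQ; apply: Nw; exact: hN.
by move=> n; have [k /= nk [Ak1 Ak2]] := Aw n Logic.I; exists k.
Qed.

(** * Covers of the limsup set *)

Lemma compact_nondecreasing_cover (X : ptopologicalType) (K : set X) (O : nat -> set X) :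
  compact K -> (forall n, open (O n)) -> (forall m n, (m <= n)%N -> O m `<=` O n) ->
  K `<=` \bigcup_n O n -> exists n, K `<=` O n.
Proof.
rewrite compact_cover => cK oO ndO KO.
have [D _ KD] := cK nat setT O (fun i _ => oO i) KO.
exists (\max_(i <- finmap.enum_fset D) i)%N => x /KD[i /= iD Oix].
by apply: (ndO i) => //; exact: leq_bigmax_seq.
Qed.

Lemma closed_bigcup_itvn (X : topologicalType) (C : nat -> set X) (m n : nat) :
  (forall k, closed (C k)) -> closed (\bigcup_(k in [set k | (m <= k < n)%N]) C k).
Proof.
move=> cC; apply: closed_bigcup => [|i _]; last exact: cC.
by apply: (sub_finite_set _ (finite_II n)) => k /= /andP[].
Qed.

Section dyadic.
Context {R : realType} {d : nat}.
Implicit Types (U : set 'rV[R]_d) (s t : R).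

Lemma expn_small (z e : R) : 0 < z < 1 -> 0 < e -> exists n, z ^+ n <= e.
Proof.
move=> /andP[z0 z1] e0.
have /cvgrPdist_lt/(_ e e0)[N _ hN] : z ^+ n @[n --> \oo] --> (0 : R).
  by apply: cvg_expr; rewrite gtr0_norm.
exists N; have := hN N (leqnn N); rewrite sub0r normrN => /ltW.
by rewrite ger0_norm//; exact/exprn_ge0/ltW.
Qed.

Lemma dyadic_scale (D : R) : 0 < D < 1 -> exists m, 2 ^- m.+1 <= D < 2 ^- m.
Proof.
move=> /andP[D0 D1].
have [n hn] : exists n, (2^-1 : R) ^+ n <= D.
  by apply: expn_small => //; rewrite invr_gt0 ltr0n invf_lt1 ?ltr1n.
have ex : exists n, (2 : R) ^- n.+1 <= D.
  by exists n; rewrite (le_trans _ hn)// exprVn lef_pV2 ?posrE ?exprn_gt0// ler_eXn2l// ltr1n.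
exists (ex_minn ex); case: ex_minnP => m -> hm /=.
case: m hm => [|m] hm; first by rewrite expr0 invr1.
by rewrite ltNge; apply/negP => /hm; rewrite ltnn.
Qed.

Lemma diam_enorm_le U x y : U x -> U y -> ((enorm (x - y))%:E <= diam U)%E.
Proof. by move=> Ux Uy; apply: ereal_sup_ubound; exists x, y. Qed.

(** Replaces a covering set by an open ball around one of its points, of the dyadic radius 2^(-m)
    with D < 2^(-m) <= 2 D for the diameter D. As D < 1 and s < t, D^t <= D^s. The error [e] pays
    for empty sets and for sets of diameter 0, which get a ball as small as needed. *)
Lemma dyadic_cover U s t (e : R) : 0 <= s -> s < t -> 0 < e ->
  (diam U <= (2^-1)%:E)%E -> exists x m, U `<=` eball x (2 ^- m) /\
    (((2 `^ t) ^- m)%:E <= (2 `^ t)%:E * diam_pow s U + e%:E)%E.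
Proof.
move=> s0 st e0 dU.
have t0 : 0 < t by exact: le_lt_trans st.
have tau0 : 0 < 2 `^ t :> R by exact: powR_gt0.
have tau1 : 1 < 2 `^ t :> R.
  by rewrite -[ltLHS](powRr0 2) /powR !pnatr_eq0/= ltr_expR ltr_pM2r ?ln_gt0// ltr1n.
have [M hM] : exists M, (2 `^ t)^-1 ^+ M <= e.
  by apply: expn_small => //; rewrite invr_gt0 tau0 invf_lt1.
have [->|/set0P[x Ux]] := eqVneq U set0.
  exists 0, M; split => //.
  by rewrite /diam_pow asboolT// mule0 add0e lee_fin -exprVn.
have U0 : U <> set0 by move=> U0; move: Ux; rewrite U0.
have d0 : (0 <= diam U)%E.
  by apply: le_trans (diam_enorm_le Ux Ux); rewrite lee_fin enorm_ge0.
move: dU d0 (@diam_enorm_le U); rewrite /diam_pow asboolF//.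
case: (diam U) => [D| |]//; rewrite !lee_fin => D2 D0 hD.
have [DE|Dn0] := eqVneq D 0.
  exists x, M; split.
    move=> y Uy; rewrite /eball/= (le_lt_trans (y := D)) ?DE ?invr_gt0 ?exprn_gt0//.
    by rewrite -lee_fin -DE; exact: hD.
  apply: (@le_trans _ _ (e%:E)); first by rewrite lee_fin -exprVn.
  by rewrite leeDr// mule_ge0// ?lee_fin ?powR_ge0.
have Dgt0 : 0 < D by rewrite lt_neqAle eq_sym Dn0.
have D1 : D < 1 by rewrite (le_lt_trans D2)// invf_lt1 ?ltr1n.
have [|m /andP[m1 m2]] := @dyadic_scale D; first by rewrite Dgt0.
exists x, m; split.
  move=> y Uy; rewrite /eball/= (le_lt_trans _ m2)//.
  by rewrite -lee_fin; exact: hD.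
apply: (@le_trans _ _ ((2 `^ t)%:E * (D%:E `^ s))%E); last first.
  by rewrite leeDl// lee_fin ltW.
rewrite poweR_EFin -EFinM lee_fin.
apply: (@le_trans _ _ (2 `^ t * D `^ t)); last first.
  by rewrite ler_wpM2l ?powR_ge0// ger_powR ?Dgt0 ?(ltW D1)// ltW.
apply: (@le_trans _ _ (2 `^ t * (2 ^- m.+1) `^ t)); last first.
  by rewrite ler_wpM2l ?powR_ge0// ge0_ler_powR ?nnegrE ?invr_ge0 ?exprn_ge0// ltW.
rewrite -powRM ?invr_ge0 ?exprn_ge0// exprS invfM mulVKf//.
by rewrite (powR_exprV t m (ler0n R 2)) powRN exprVn.
Qed.

End dyadic.

Section covering_lower_bound.
Context {R : realType} {d : nat} (mu : probability (borelRd R d) R).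
Local Notation T := (borelRd R d).
Context (F : set T) (rho r : nat -> R) (s t : R) (blk : nat -> nat) (w : seqRd R d).
Hypotheses (mF : measurable F) (cF : compact (F : set 'rV[R]_d)).
Hypothesis blk_lt : forall j, (blk j < blk j.+1)%N.
Hypothesis rho_lt : forall k, (blk 0 <= k)%N -> rho k < r k.
Hypothesis block_sum_gt0 : forall j, 0 < block_sum rho s blk j.
Local Notation cascade := (cascade mu F rho s blk).
Local Notation ball_of k := [set y : 'rV[R]_d | enorm (y - (w : nat -> 'rV[R]_d) k) <= rho k].

(** Decreasing compact sets that contain the points where the cascades do not vanish. The balls are
    closed and have the smaller radii [rho k], so that the intersection of all traps still lies in
    the limsup set of the open balls. *)
Definition trap (n : nat) : set 'rV[R]_d := F `&`
  \bigcap_(j in [set j | (j < n)%N]) \bigcup_(k in [set k | (blk j <= k < blk j.+1)%N]) ball_of k.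

Lemma closed_trap n : closed (trap n).
Proof.
apply: closedI.
  by apply: compact_closed => //; exact: norm_hausdorff.
apply: closed_bigI => j _; apply: closed_bigcup_itvn => k.
exact: closed_enormB_le.
Qed.

Lemma trap_cascade n x : cascade n x w != 0 -> trap n x.
Proof.
rewrite mulf_eq0 negb_or => /andP[Fx px]; split.
  by move: Fx; rewrite indicE pnatr_eq0 eqb0 negbK inE.
move=> j /= jn; apply: contrapT => h; move/eqP: px; apply.
rewrite (bigD1 (Ordinal jn))//= [weight _ _ _ _ _ _ _ _]big_nat big1 ?mul0r// => k kj.
rewrite indicE memNset ?mulr0// => xk; apply: h; exists k => //=.
by rewrite enormB; exact: ltW.
Qed.

Lemma trap_covering x : (forall n, trap n x) -> covering_set r w x.
Proof.
move=> hx N _.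
have blk_ge j : (j <= blk j)%N.
  by elim: j => // j IH; exact: leq_ltn_trans (blk_lt j).
have [_ /(_ N (ltnSn N))[k /= /andP[k1 k2] xk]] := hx N.+1.
exists k => /=; first exact: leq_trans k1.
rewrite /eball/= (le_lt_trans xk)// rho_lt//.
by apply: leq_trans k1; apply: blk_ge0 => j; exact: ltnW.
Qed.

(** Each point of [F] either leaves some trap or lies in the limsup set, hence in some [V i]. The
    complements of the traps together with finite unions of the [V i] thus form an increasing open
    cover of the compact set [F]. *)
Lemma trap_cover (V : nat -> set 'rV[R]_d) : (forall i, open (V i)) ->
  covering_set r w `<=` \bigcup_i V i ->
  exists n, forall n', (n <= n')%N -> trap n' `<=` \bigcup_(i in [set i | (i < n)%N]) V i.
Proof.
move=> oV EV.
pose O n := (\bigcup_(i in [set i | (i < n)%N]) V i) `|` ~` trap n.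
have trapS m n : (m <= n)%N -> trap n `<=` trap m.
  by move=> mn x [Fx hx]; split => // j /= jm; apply: hx; exact: leq_trans mn.
have [n hn] : exists n, (F : set 'rV[R]_d) `<=` O n.
  apply: compact_nondecreasing_cover => //.
  - move=> n; apply: openU; first by apply: bigcup_open => i _; exact: oV.
    by rewrite openC; exact: closed_trap.
  - move=> m n mn x [[i /= im Vx]|tx]; first by left; exists i => //=; exact: leq_trans mn.
    by right => /(trapS _ _ mn).
  - move=> x Fx; have [hx|] := pselect (forall n, trap n x).
      have [i _ Vx] := EV _ (trap_covering hx).
      by exists i.+1 => //; left; exists i => /=.
    by move=> /existsNP[n hn]; exists n => //; right.
exists n => n' nn' x tx; have [//|] := hn x (proj1 tx).
by move=> ntx; exfalso; apply: ntx; exact: trapS tx.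
Qed.

(** If the s'-dimensional measure vanished for some s' < t, a cover with a tiny sum would yield
    finitely many dyadic balls covering every late trap. Then [mass_le_cover_energy] would push the
    mass of a late cascade of bounded energy below [m]. *)
Lemma hausdorff_dim_covering_ge (m L : R) : 0 < m -> 0 < L -> 
  (forall n, exists k, [/\ (n <= k)%N, (m%:E <= cascade_mass mu F rho s blk k w)%E &
    (cascade_energy mu F rho s t blk k w <= L%:E)%E]) ->
  (t%:E <= hausdorff_dim (covering_set r w))%E.
Proof.
move=> m0 L0 hw.
apply: le_ereal_inf_tmp => _ [s' /= [s'0 Hs'] <-]; rewrite lee_fin leNgt; apply/negP => st.
pose tau : R := 2 `^ t.
have tau0 : 0 < tau by exact: powR_gt0.
(* The constants make L / lam = m / 2 and lam (tau + 2) e = m / 4, for a total of 3 m / 4 < m. *)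
pose lam := 2 * L / m.
have lam0 : 0 < lam by rewrite divr_gt0// mulr_gt0.
pose c := m / (2 * lam).
have c0 : 0 < c by rewrite divr_gt0// mulr_gt0.
pose e := c / (2 * (tau + 2)).
have tau2 : 0 < 2 * (tau + 2) by rewrite mulr_gt0// addr_gt0.
have e0 : 0 < e by rewrite divr_gt0.
(* The scale 1/2 is the bound on diameters under which [dyadic_cover] applies. *)
have : (hausdorff_premeasure s' 2^-1 (covering_set r w) < e%:E)%E.
  apply: (@le_lt_trans _ _ 0%E); last by rewrite lte_fin.
  by rewrite -Hs'; apply: ereal_sup_ubound; exists 2^-1 => //=; rewrite invr_gt0.
move=> /ereal_inf_lt[_ [U [EU dU] <-] sumU].
have hx i : exists xm : 'rV[R]_d * nat, U i `<=` eball xm.1 (2 ^- xm.2) /\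
    ((tau ^- xm.2)%:E <= tau%:E * diam_pow s' (U i) + (e * 2^-1 ^+ i)%:E)%E.
  have ei : 0 < e * 2^-1 ^+ i by rewrite mulr_gt0// exprn_gt0// invr_gt0.
  by have [x [k h]] := dyadic_cover s'0 st ei (dU i); exists (x, k).
have [xm hxm] := choice hx.
pose V i := eball (xm i).1 (2 ^- (xm i).2).
have [n hn] : exists n, forall n',
  (n <= n')%N -> trap n' `<=` \bigcup_(i in [set i | (i < n)%N]) V i.
  apply: trap_cover => [i|x /EU[i _ Ux]]; first exact: open_eball.
  by exists i => //; exact: (hxm i).1.
have [k [nk mk Lk]] := hw n.
have diam0 i : (0 <= diam_pow s' (U i))%E by rewrite /diam_pow; case: ifP => // _; exact: poweR_ge0.
have sum_le : \sum_(i < n) tau ^- (xm i).2 <= tau * e + 2 * e.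
  rewrite -lee_fin -sumEFin.
  apply: (@le_trans _ _ (\sum_(i < n) (tau%:E * diam_pow s' (U i) + (e * 2^-1 ^+ i)%:E))%E).
    by apply: lee_sum => i _; exact: (hxm i).2.
  rewrite big_split/= EFinD leeD//.
    rewrite -ge0_sume_distrr// EFinM lee_wpmul2l// ?lee_fin ?(ltW tau0)//.
    rewrite (le_trans _ (ltW sumU))// -(big_mkord xpredT (fun i => diam_pow s' (U i))).
    exact: nneseries_lim_ge.
  rewrite sumEFin lee_fin.
  have := @geometric_le_lim R n e 2^-1 (ltW e0).
  rewrite /series/= big_mkord => h.
  rewrite (le_trans (h _ _))// ?invr_gt0//; first by rewrite ger0_norm ?invr_ge0// invf_lt1 ?ltr1n.
  rewrite mulrC ler_wpM2r ?(ltW e0)//.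
  have -> : 1 - 2^-1 = 2^-1 :> R by field.
  by rewrite invrK.
have := @mass_le_cover_energy R d mu tau lam V (fun i => (xm i).2) n (fun x =>
  cascade k x w) tau0 lam0.
have h1 i : measurable (V i : set T) by exact: measurable_eball.
have h2 i (x y : T) : V i x -> V i y -> eball x (2 / 2 ^+ (xm i).2) y.
  rewrite /V /eball/= => hx1 hy1.
  have := enorm_triangle y (xm i).1 x; rewrite (enormB (xm i).1 x).
  by move: hx1 hy1; set v := 2 ^- _ => hx1 hy1; rewrite -/v; lra.
have h3 : measurable_fun setT (fun x : T => cascade k x w).
  exact: (measurable_cascade mu mF _ _ _ _ (@measurable_id _ T setT) (measurable_cst w)).
have h4 x : 0 <= cascade k x w by exact: cascade_ge0.
have h5 x : cascade k x w != 0 -> exists2 i, (i < n)%N & V i x.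
  by move=> /trap_cascade/(hn _ nk)[i /= ni Vi]; exists i.
move=> /(_ h1 h2 h3 h4 h5) hmass.
have : (m%:E <= (lam * (tau * e + 2 * e) + lam^-1 * L)%:E)%E.
  apply: (le_trans mk); apply: (le_trans hmass).
  rewrite EFinD leeD ?lee_fin ?ler_wpM2l ?(ltW lam0)//.
  by rewrite EFinM lee_wpmul2l// lee_fin invr_ge0 ltW.
rewrite lee_fin => hm.
suff : lam * (tau * e + 2 * e) + lam^-1 * L < m by rewrite ltNge hm.
rewrite (_ : _ + _ = 3 / 4 * m); first by rewrite gtr_pMl//; lra.
by rewrite /e /c /lam; field; rewrite !gt_eqF ?addr_gt0.
Qed.

End covering_lower_bound.

(** * Lower bound from a regular set *)

Lemma rational_vector_approx (R : realType) (d : nat) (x : 'rV[R]_d) (e : R) : 0 < e ->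
  exists q : 'rV[rat]_d, enorm (x - map_mx ratr q) < e.
Proof.
move=> e0; pose e' := e / d.+1%:R.
have e'0 : 0 < e' by rewrite divr_gt0.
have hq i : exists q : rat, x ord0 i - e' < ratr q < x ord0 i + e'.
  have [|q] := @rat_in_itvoo R (x ord0 i - e') (x ord0 i + e'); first by lra.
  by rewrite in_itv/= => h; exists q.
have [q hq'] := choice hq.
exists (\row_i q i).
rewrite -(@ltr_pXn2r _ 2)// ?nnegrE ?enorm_ge0 ?ltW// enorm_sqr.
apply: (@le_lt_trans _ _ (\sum_(i < d) e' ^+ 2)).
  apply: ler_sum => i _; rewrite !mxE -[leLHS]real_normK ?num_real//.
  rewrite ler_pXn2r ?nnegrE ?(ltW e'0)// ltW//.
  by rewrite ltr_norml; have := hq' i; lra.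
rewrite sumr_const card_ord -[ltLHS]mulr_natr /e' expr_div_n -mulrA gtr_pMr ?exprn_gt0//.
have D0 : 0 <= d%:R :> R by exact: ler0n.
by rewrite mulrC ltr_pdivrMr ?exprn_gt0// mul1r -natr1; nra.
Qed.

Section support.
Context {R : realType} {d : nat} (mu : probability (borelRd R d) R).

(** A point off the support has a null ball, which contains a smaller ball with rational centre and
    dyadic radius still containing the point. There are countably many such balls, enumerated here
    by [unpickle]. *)
Lemma negligible_sptC : mu.-negligible (~` spt mu : set (borelRd R d)).
Proof.
pose B n : set (borelRd R d) := if unpickle n is Some (q, m) then
   let V := eball (map_mx ratr q : 'rV[R]_d) (2 ^- m) in
   if mu V == 0%E then V else set0 else set0.
apply: (@negligibleS _ _ _ _ (\bigcup_n B n)).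
  move=> x /= /existsNP[e /not_implyP[e0 /negP]]; rewrite -leNgt => xe.
  have [m hm] := @expn_small R 2^-1 (e / 2) ltac:(by rewrite invr_gt0 ltr0n invf_lt1 ?ltr1n) (divr_gt0 e0 (ltr0n _ 2)).
  rewrite exprVn in hm.
  have m0 : 0 < 2 ^- m :> R by rewrite invr_gt0 exprn_gt0.
  have [q hq] := rational_vector_approx x m0.
  exists (pickle (q, m)) => //; rewrite /B pickleK /=.
  case: ifPn => [_|/negP]; first by [].
  case; rewrite -measure_le0 (le_trans _ xe)// le_measure ?inE//;
    [exact: measurable_eball|exact: measurable_eball|].
  by apply: sub_eball; rewrite enormB; lra.
apply: negligible_bigcup => n; rewrite /B.
case: (unpickle n) => [[q m]|]; last exact: negligible_set0.
case: ifPn => [/eqP V0|_]; last exact: negligible_set0.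
by apply/negligibleP => //; exact: measurable_eball.
Qed.

Lemma ae_product_spt (P : probability (seqRd R d) R) : is_product_measure mu P ->
  \forall w \ae P, forall k, spt mu ((w : nat -> 'rV[R]_d) k).
Proof.
move=> P_prod; apply/ae_foralln => k.
have [N [mN N0 hN]] := negligible_sptC.
exists [set w : seqRd R d | N ((w : nat -> 'rV[R]_d) k)]; split.
- by have := measurable_seqRd_coord k measurableT mN; rewrite setTI.
- pose A i : set (borelRd R d) := if i == k then N else setT.
  have mA i : measurable (A i) by rewrite /A; case: ifP.
  have := P_prod k.+1 A mA.
  rewrite big_ord_recr/= [X in (_ * mu X)%E](_ : _ = N); last by rewrite /A eqxx.
  rewrite N0 mule0 => <-; congr (P _); apply/seteqP; split => w /=.
    by move=> Nw i _; rewrite /A; case: eqVneq => // ->.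
  by move=> /(_ k (ltnSn k)); rewrite /A eqxx.
- by move=> w /= nw; exact: hN.
Qed.

End support.

Lemma unbounded_blocks (R : realType) (u : nat -> R) (a : nat) (B : R) :
  (forall k, 0 <= u k) -> (\sum_(0 <= k <oo) (u k)%:E = +oo)%E ->
  exists2 a', (a < a')%N & B <= \sum_(a <= k < a') u k.
Proof.
move=> u0 su; apply: contrapT => h.
have hB n : (a < n)%N -> \sum_(a <= k < n) u k < B.
  by move=> an; rewrite ltNge; apply/negP => Bn; apply: h; exists n.
suff : (\sum_(0 <= k <oo) (u k)%:E <= (\sum_(0 <= k < a) u k + `|B|)%:E)%E by rewrite su leye_eq.
apply: lime_le; first by apply: is_cvg_nneseries => k _ _; rewrite lee_fin.
apply: nearW => n; rewrite sumEFin lee_fin.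
have [na|an] := leqP n a.
  rewrite (big_cat_nat (leq0n _) na)/= -addrA lerDl addr_ge0// sumr_ge0//.
rewrite (big_cat_nat (leq0n _) (ltnW an))/= lerD2l (le_trans (ltW (hB _ an)))//.
exact: ler_norm.
Qed.

Lemma as_dim_ge (R : realType) (d : nat) (mu : probability (borelRd R d) R)
    (r : nat -> R) (P : probability (seqRd R d) R) (f : \bar R)
    (F : set 'rV[R]_d) (A a b s t : R) :
  (forall k, 0 < r k) -> r @ \oo --> (0 : R) -> is_product_measure mu P -> is_as_dim mu P r f ->
  compact F -> (0 < mu F)%E -> 0 < A -> 0 <= a ->
  (forall x, F x -> forall e, 0 < e -> ballm mu e x <= A * e `^ a) ->
  (forall x, F x -> forall e, 0 < e <= 1 -> e `^ b <= A * ballm mu e x) ->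
  0 < s -> s <= b -> t < a * (s / b) ->
  (\sum_(0 <= k <oo) (r k `^ s)%:E = +oo)%E ->
  (t%:E <= f)%E.
Proof.
move=> r0 rcvg P_prod f_as cF F0 A0 a0 hup hlo s0 sb tq rsum.
have b0 : 0 < b by rewrite (lt_le_trans s0).
have mF : measurable (F : set (borelRd R d)).
  by apply: closed_measurableRd; apply: compact_closed => //; exact: norm_hausdorff.
have [C1 C10 hC1] := integral_riesz_pair_density mF A0 hup hlo s0 sb tq.
have ta : t < a.
  by rewrite (lt_le_trans tq)// ler_piMr// ler_pdivrMr ?mul1r.
have [C0 C00 hC0] := integral_riesz_le_cst A0 hup ta.
(* Halving leaves room for a closed ball of radius [rho k] inside the open ball of radius [r k]. *)
pose rho k := r k / 2.
have rho0 k : 0 < rho k by rewrite divr_gt0.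
have [N0 hN0] : exists N0, forall k, (N0 <= k)%N -> rho k <= 1.
  have /cvgrPdist_lt/(_ 1 ltr01)[N0 _ h] := rcvg.
  exists N0 => k Nk; have := h k Nk; rewrite sub0r normrN gtr0_norm// => rk.
  by rewrite /rho; have := r0 k; lra.
have rhosum : (\sum_(0 <= k <oo) (rho k `^ s)%:E = +oo)%E.
  rewrite (eq_eseriesr (g := fun k => ((2^-1 `^ s)%:E * (r k `^ s)%:E)%E)); last first.
    by move=> k _; rewrite -EFinM /rho powRM ?(ltW (r0 k))// mulrC.
  rewrite nneseriesZl ?rsum ?gt0_muley ?lte_fin ?powR_gt0//.
  by move=> k _; rewrite lee_fin powR_ge0.
(* Here [m] is the start of the block. Since [j <= blk j], the power 2^(m+1) dominates the 2^(j+1)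
   required by [growth]; the summand 1 makes block sums positive. *)
pose bnd m := C1 * correlation_bound A b rho N0 m * 2 ^+ m.+1 + 1.
have /choice[nxt hnxt] m : exists m', (m < m')%N /\ bnd m <= \sum_(m <= k < m') rho k `^ s.
  have [m' mm' h] := @unbounded_blocks R (fun k => rho k `^ s) m (bnd m) (fun k =>
    powR_ge0 _ _) rhosum.
  by exists m'.
pose blk j := iter j nxt N0.
have blk_lt j : (blk j < blk j.+1)%N by exact: (hnxt _).1.
have blk_le j : (blk j <= blk j.+1)%N by exact: ltnW.
have blk_ge j : (j <= blk j)%N.
  by elim: j => // j IH; exact: leq_ltn_trans (blk_lt j).
have cb0 m : 0 <= correlation_bound A b rho N0 m.
  by apply: prodr_ge0 => k _; rewrite addr_ge0// mulr_ge0 ?powR_ge0 ?ltW.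
have bs j : bnd (blk j) <= block_sum rho s blk j by exact: (hnxt (blk j)).2.
have bs0 j : 0 < block_sum rho s blk j.
  by apply: lt_le_trans (bs j); rewrite ltr_wpDl// !mulr_ge0// exprn_ge0.
have growth j : C1 * correlation_bound A b rho (blk 0%N) (blk j) * 2 ^+ j.+1 <= block_sum rho s blk j.
  apply: le_trans (bs j); rewrite /bnd -[leLHS]addr0 lerD//.
  by rewrite ler_wpM2l ?mulr_ge0// ler_eXn2l ?ltr1n// ltnS.
have rho01 k : (blk 0%N <= k)%N -> 0 < rho k <= 1 by move=> h; rewrite rho0 hN0.
have Ffin : mu F \is a fin_num by rewrite fin_num_measure.
have m0 : 0 < fine (mu F) by rewrite fine_gt0// F0 ltey_eq Ffin.
(* [is_as_dim] gives the dimension only for sequences in the support, which are almost all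
   sequences. *)
have : \forall w \ae P, (forall k, spt mu ((w : nat -> 'rV[R]_d) k)) /\
    ((forall k, spt mu ((w : nat -> 'rV[R]_d) k)) -> hausdorff_dim (covering_set r w) = f).
  apply: (@filterI _ _ (@ae_filter_ringOfSetsType _ (seqRd R d) R P)); last exact: f_as.
  exact: ae_product_spt.
have C2 : 0 < C0 + 1 by rewrite ltr_wpDl.
move=> /(moments_infinitely_often m0 C2
  (measurable_cascade_mass mu mF bs0) (measurable_cascade_energy mu mF t bs0)
  (cascade_mass_ge0 mu F bs0) (cascade_massM_le mu mF t bs0)).
have EX n : (\int[P]_w cascade_mass mu F rho s blk n w = (fine (mu F))%:E)%E.
  by rewrite fineK//; exact: (expectation_cascade_mass P_prod mF A0 hlo rho01 blk_le bs0).
have EY n : (\int[P]_w cascade_energy mu F rho s t blk n w <= (C0 + 1)%:E)%E.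
  exact: (expectation_cascade_energy_le P_prod mF A0 hlo rho01 blk_le bs0 hC0 hC1 growth).
move=> /(_ EX EY)[w [sw /(_ sw) <-]] hw.
have L0 : 0 < (4 * (C0 + 1) / fine (mu F)) ^+ 2 by rewrite exprn_gt0// divr_gt0// mulr_gt0.
apply: (hausdorff_dim_covering_ge mF cF blk_lt _ bs0 _ L0 hw); last by rewrite divr_gt0.
by move=> k _; rewrite /rho; have := r0 k; lra.
Qed.

(** * Local dimensions *)

Lemma at_right0P (R : realType) (V : set R) : (0 : R)^'+ V ->
  exists2 e0, 0 < e0 & forall e, 0 < e < e0 -> V e.
Proof.
move=> /nbhs_ballP[e0 /= e00 hV]; exists e0 => // e /andP[e1 e2].
by apply: hV => //=; rewrite /ball/= sub0r normrN gtr0_norm.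
Qed.

Section local_dimension.
Context {R : realType} {d : nat} (mu : probability (borelRd R d) R).
Local Notation T := (borelRd R d).
Implicit Types (x : T) (a b e : R).

Lemma lower_dim_loc_gt x a : (a%:E < lower_dim_loc mu x)%E ->
  exists2 e0, 0 < e0 & forall e, 0 < e < e0 -> (a%:E < log_ratio mu x e)%E.
Proof.
rewrite /lower_dim_loc limf_einfE => /ereal_sup_gt[_ [V V0 <-] aV].
have [e0 e00 hV] := at_right0P V0; exists e0 => // e /hV Ve.
by rewrite (lt_le_trans aV)//; apply: ereal_inf_lbound; exists e.
Qed.

Lemma upper_dim_loc_lt x b : (upper_dim_loc mu x < b%:E)%E ->
  exists2 e0, 0 < e0 & forall e, 0 < e < e0 -> (log_ratio mu x e < b%:E)%E.
Proof.
rewrite /upper_dim_loc limf_esupE => /ereal_inf_lt[_ [V V0 <-] aV].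
have [e0 e00 hV] := at_right0P V0; exists e0 => // e /hV Ve.
by rewrite (le_lt_trans _ aV)//; apply: ereal_sup_ubound; exists e.
Qed.

Lemma log_ratio_bounds x a b e : 0 < e < 1 ->
  (a%:E < log_ratio mu x e)%E -> (log_ratio mu x e < b%:E)%E ->
  e `^ b <= ballm mu e x <= e `^ a.
Proof.
move=> /andP[e0 e1]; rewrite /log_ratio -ballmE.
have le0 : ln e < 0 by rewrite ln_lt0// e0.
rewrite inver lt_eqF//=.
(* A null ball has log ratio [+oo], which the upper bound excludes. *)
have := ballm_ge0 mu e x; rewrite le_eqVlt => /predU1P[<-|p0].
  by rewrite lexx lt0_mulNye ?lte_fin ?invr_lt0// ltNge leey.
rewrite leNgt p0/= -EFinM !lte_fin ltr_ndivlMr// ltr_ndivrMr// => h1 h2.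
rewrite /powR gt_eqF//= -[ballm mu e x]lnK ?posrE//.
by rewrite !ler_expR !ltW.
Qed.

Lemma local_dims_lt x a b :
  (a%:E < lower_dim_loc mu x)%E -> (upper_dim_loc mu x < b%:E)%E -> a < b.
Proof.
move=> /lower_dim_loc_gt[e1 e10 h1] /upper_dim_loc_lt[e2 e20 h2].
have m0 : 0 < Num.min e1 e2 by rewrite lt_min e10.
pose e := Num.min e1 e2 / 2.
have e0 : 0 < e by rewrite divr_gt0.
have em : e < Num.min e1 e2 by rewrite gtr_pMr// invf_lt1 ?ltr1n.
rewrite -lte_fin; apply: (lt_trans (h1 e _) (h2 e _)); rewrite e0/=.
  by rewrite (lt_le_trans em)// ge_min lexx.
by rewrite (lt_le_trans em)// ge_min lexx orbT.
Qed.

(** Only the closure of this set, which is Borel, is ever measured. *)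
Definition regular_set a b (A : R) : set T :=
  [set x | (forall e, 0 < e -> ballm mu e x <= A * e `^ a) /\
           (forall e, 0 < e <= 1 -> e `^ b <= A * ballm mu e x)].

(** The local dimensions give both power bounds below some scale [e3]. At larger radii they follow
    from measure at most 1 and from monotonicity, once the constant dominates e0^(-a) and e0^(-b)
    for a fixed e0 < e3. *)
Lemma regular_set_cover x a b : 0 <= a -> 0 <= b ->
  (a%:E < lower_dim_loc mu x)%E -> (upper_dim_loc mu x < b%:E)%E ->
  exists N : nat, regular_set a b N.+1%:R x.
Proof.
move=> a0 b0 /lower_dim_loc_gt[e1 e10 h1] /upper_dim_loc_lt[e2 e20 h2].
pose e3 := Num.min (Num.min e1 e2) 1.
have e30 : 0 < e3 by rewrite !lt_min e10 e20 ltr01.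
pose e0 := e3 / 2.
have e00 : 0 < e0 by rewrite divr_gt0.
have e0lt : e0 < e3 by rewrite gtr_pMr// invf_lt1 ?ltr1n.
have hb e : 0 < e < e3 -> e `^ b <= ballm mu e x <= e `^ a.
  move=> /andP[ee0]; rewrite !lt_min => /andP[/andP[ee1 ee2] ee3].
  by apply: log_ratio_bounds; rewrite ?ee0// ?h1 ?h2 ?ee0.
have e01 : e0 <= 1.
  by rewrite ltW// (lt_le_trans e0lt)// ge_min lexx orbT.
pose N := Num.truncn (e0 `^ (- a) + e0 `^ (- b)).
have hN : e0 `^ (- a) + e0 `^ (- b) <= N.+1%:R.
  by rewrite ltW// truncnS_gt.
have pa : 0 <= e0 `^ (- a) by exact: powR_ge0.
have pb : 0 <= e0 `^ (- b) by exact: powR_ge0.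
have N1 : 1 <= N.+1%:R :> R by rewrite ler1n.
exists N; split.
  move=> e ee0; have [ee|ee] := ltP e e3.
    have /andP[_ h] := hb e ltac:(by rewrite ee0).
    by rewrite (le_trans h)// ler_peMl ?powR_ge0.
  rewrite (le_trans (ballm_le1 _ _ _))//.
  have h : e0 `^ (- a) * e `^ a <= N.+1%:R * e `^ a.
    by rewrite ler_wpM2r ?powR_ge0// (le_trans _ hN)// lerDl.
  rewrite (le_trans _ h)// powRN mulrC ler_pdivlMr ?powR_gt0// mul1r.
  by apply: ge0_ler_powR; rewrite ?nnegrE ?(ltW e00) ?(ltW ee0)//; exact: ltW (lt_le_trans e0lt ee).
move=> e /andP[ee0 ee1]; have [ee|ee] := ltP e e3.
  have /andP[h _] := hb e ltac:(by rewrite ee0).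
  by rewrite (le_trans h)// ler_peMl ?ballm_ge0.
have h0 : e0 `^ b <= ballm mu e x.
  have /andP[h _] := hb e0 ltac:(by rewrite e00 e0lt).
  rewrite (le_trans h)// le_ballm//; apply: sub_eball.
  by rewrite subrr enorm0 add0r ltW// (lt_le_trans e0lt).
apply: (@le_trans _ _ 1).
  rewrite [leRHS](_ : 1 = 1 `^ b); last by rewrite powR1.
  by apply: ge0_ler_powR; rewrite ?nnegrE ?(ltW ee0).
apply: (@le_trans _ _ (e0 `^ (- b) * e0 `^ b)).
  by rewrite powRN mulVf// gt_eqF// powR_gt0.
by rewrite ler_pM ?powR_ge0// (le_trans _ hN)// lerDr.
Qed.

(* Enlarging the constant pays for comparing balls of radius e around y with balls of
   radius 2 e or e / 2 around a point close to y. *)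
Lemma closure_regular_set a b A : 0 <= a -> 0 <= b -> 0 <= A ->
  closure (regular_set a b A : set 'rV[R]_d) `<=` regular_set a b (A * 2 `^ a * 2 `^ b).
Proof.
move=> a0 b0 A0 y cy.
have near e : 0 < e -> exists2 x, regular_set a b A x & enorm (x - y) < e.
  move=> e0; have [|x [Rx yx]] := cy (eball y e); last by exists x.
  by apply: open_nbhs_nbhs; split; [exact: open_eball|exact: eball_center].
have p2 c : 0 <= c -> 1 <= 2 `^ c :> R.
  by move=> c0; rewrite -[leLHS](powRr0 2) ler_powR// ler1n.
split=> e.
  move=> e0; have [x [Rx _] xy] := near e e0.
  apply: (@le_trans _ _ (ballm mu (2 * e) x)).
    by apply: le_ballm; apply: sub_eball; rewrite enormB; lra.
  rewrite (le_trans (Rx _ _)) ?mulr_gt0// powRM// ?(ltW e0)//.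
  rewrite [leRHS](_ : _ = 2 `^ b * (A * (2 `^ a * e `^ a))); last by ring.
  by rewrite ler_peMl ?p2// mulr_ge0// mulr_ge0 ?powR_ge0.
move=> /andP[e0 e1]; have e20 : 0 < e / 2 by rewrite divr_gt0.
have [x [_ Rx] xy] := near _ e20.
have h1 : (e / 2) `^ b <= A * ballm mu (e / 2) x by apply: Rx; rewrite e20/=; lra.
have h2 : ballm mu (e / 2) x <= ballm mu e y.
  by apply: le_ballm; apply: sub_eball; lra.
have -> : e `^ b = 2 `^ b * (e / 2) `^ b.
  by rewrite -powRM ?(ltW e20)// mulrC divfK.
rewrite [leRHS](_ : _ = 2 `^ a * (2 `^ b * (A * ballm mu e y))); last by ring.
apply: (@le_trans _ _ (2 `^ b * (A * ballm mu e y))).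
  by rewrite ler_wpM2l ?powR_ge0// (le_trans h1)// ler_wpM2l.
by rewrite ler_peMl ?p2// mulr_ge0 ?powR_ge0// mulr_ge0 ?ballm_ge0.
Qed.

End local_dimension.

(** * Regular sets of positive measure *)

Lemma ereal_rat_between (R : realType) (c : R) (l : \bar R) : (c%:E < l)%E ->
  exists2 q : rat, c < ratr q & ((ratr q : R)%:E < l)%E.
Proof.
case: l => [l| |]//.
- rewrite lte_fin => /rat_in_itvoo[q]; rewrite in_itv/= => /andP[q1 q2].
  by exists q.
- move=> _; have [|q] := @rat_in_itvoo R c (c + 1); first by rewrite ltrDl.
  by rewrite in_itv/= => /andP[q1 _]; exists q => //; rewrite ltry.
Qed.

(** Rational exponents make the family of regular sets countable. *)
Lemma local_dims_rat (R : realType) (d : nat) (mu : probability (borelRd R d) R)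
    (x : borelRd R d) (s u : R) : 0 <= s -> 0 < u ->
  (s%:E < lower_dim_loc mu x)%E -> (u%:E < lower_dim_loc mu x / upper_dim_loc mu x)%E ->
  exists qa qb : rat, [/\ s < ratr qa, u * ratr qb <= ratr qa,
    ((ratr qa : R)%:E < lower_dim_loc mu x)%E & (upper_dim_loc mu x < (ratr qb : R)%:E)%E].
Proof.
move=> s0 u0 sl; have [q0 sq0 q0l] := ereal_rat_between sl.
have uq : ((ratr q0 : R)%:E <= upper_dim_loc mu x)%E.
  by rewrite leNgt; apply/negP => /(local_dims_lt q0l); rewrite ltxx.
have q00 : 0 < ratr q0 :> R by exact: le_lt_trans sq0.
move: uq (@local_dims_lt _ _ mu x); case: (upper_dim_loc mu x) => [v| |] => // qv hlt.
- have v0 : 0 < v by rewrite (lt_le_trans q00)// -lee_fin.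
  rewrite inver gt_eqF// => ul.
  have uvl : ((u * v)%:E < lower_dim_loc mu x)%E.
    rewrite EFinM -lte_pdivlMr//.
  (* Taking [qa] above u v leaves room for [qb] between v and qa / u. *)
  have : ((Num.max s (u * v))%:E < lower_dim_loc mu x)%E by rewrite EFin_max gt_max sl.
  move=> /ereal_rat_between[qa]; rewrite gt_max => /andP[sqa uvqa] qal.
  have [|qb] := @rat_in_itvoo R v (ratr qa / u); first by rewrite ltr_pdivlMr// mulrC.
  rewrite in_itv/= => /andP[vqb qbu]; exists qa, qb; split => //.
    by rewrite mulrC -ler_pdivlMr// ltW.
(* With upper local dimension [+oo] the quotient is 0, contrary to u > 0. *)
- by rewrite invey mule0 lte_fin ltNge ltW.
Qed.

(** Otherwise the closures of the regular sets with suitable rational exponents and integer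
    constants are all null. Their countable union contains every point where the ratio exceeds [u],
    so the essential supremum would be at most [u]. *)
Lemma exists_regular_set (R : realType) (d : nat) (mu : probability (borelRd R d) R) (s u : R) :
  0 <= s -> 0 < u -> (u%:E < dim_loc_ratio mu s%:E)%E ->
  exists a b A, [/\ s < a, u * b <= a, a < b,
    0 < A & (0 < mu (closure (regular_set mu a b A : set 'rV[R]_d)))%E].
Proof.
move=> s0 u0 hu; apply: contrapT => hno; move: hu; apply/negP; rewrite -leNgt.
apply/ess_supP.
pose B n : set 'rV[R]_d := if unpickle n is Some (qa, qb, N) then
   if [&& s < ratr qa, u * ratr qb <= ratr qa & (ratr qa : R) < ratr qb] then
     closure (regular_set mu (ratr qa) (ratr qb) (N : nat).+1%:R : set 'rV[R]_d) else set0 else set0.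
have negB : mu.-negligible (\bigcup_n B n : set (borelRd R d)).
  apply: negligible_bigcup => n; rewrite /B.
  case: (unpickle n) => [[[qa qb] N]|]; last exact: negligible_set0.
  case: ifPn => [/and3P[h1 h2 h3]|_]; last exact: negligible_set0.
  have mC : measurable (closure (regular_set mu (ratr qa) (ratr qb) N.+1%:R : set 'rV[R]_d) : set (borelRd R d)).
    by apply: closed_measurableRd; exact: closed_closure.
  apply/negligibleP => //; apply: contrapT => /eqP C0; apply: hno.
  exists (ratr qa), (ratr qb), N.+1%:R; split => //.
  by rewrite lt_neqAle eq_sym C0/=.
apply: negligibleS negB => x /=.
case: asboolP => [sl|_]; last by rewrite leNye.
move=> /negP; rewrite -ltNge => ul.
have [qa [qb [h1 h2 h3 h4]]] := local_dims_rat s0 u0 sl ul.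
have ab := local_dims_lt h3 h4.
have a0 : 0 <= ratr qa :> R by rewrite ltW// (le_lt_trans s0).
have b0 : 0 <= ratr qb :> R by rewrite (le_trans a0)// ltW.
have [N hN] := regular_set_cover a0 b0 h3 h4.
exists (pickle (qa, qb, N)); first exact: Logic.I.
rewrite /B pickleK h1 h2 ab.
exact: subset_closure.
Qed.

Lemma regular_set_spt (R : realType) (d : nat) (mu : probability (borelRd R d) R) (a b A : R) :
  0 < A -> regular_set mu a b A `<=` spt mu.
Proof.
move=> A0 x [_ hx] e e0.
pose e' := Num.min e 1.
have e'0 : 0 < e' by rewrite lt_min e0 ltr01.
have : 0 < A * ballm mu e' x.
  by rewrite (lt_le_trans _ (hx e' _)) ?powR_gt0// e'0/= ge_min lexx orbT.
rewrite pmulr_rgt0// -lte_fin ballmE => /lt_le_trans; apply.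
rewrite le_measure ?inE//; [exact: measurable_eball|exact: measurable_eball|].
by apply: sub_eball; rewrite subrr enorm0 add0r ge_min lexx.
Qed.

(** * The critical exponent and the upper bound *)

Lemma s2_ge0 (R : realType) (r : nat -> R) : (0 <= s2 r)%E.
Proof. by apply: le_ereal_inf_tmp => _ [s [s0 _] <-]; rewrite lee_fin ltW. Qed.

Lemma hausdorff_dim_ge0 (R : realType) (d : nat) (E : set 'rV[R]_d) : (0 <= hausdorff_dim E)%E.
Proof. by apply: le_ereal_inf_tmp => _ [s [s0 _] <-]; rewrite lee_fin. Qed.

Lemma lt_s2_series (R : realType) (r : nat -> R) (s : R) : 0 < s -> (s%:E < s2 r)%E ->
  (\sum_(0 <= k <oo) (r k `^ s)%:E = +oo)%E.
Proof.
move=> s0 ss; apply/eqP; rewrite -leye_eq leNgt; apply/negP => h.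
move: ss; rewrite ltNge => /negP; apply; apply: ereal_inf_lbound.
by exists s.
Qed.

Lemma hausdorff_measure_covering_set0 (R : realType) (d : nat) (r : nat -> R)
    (w : nat -> 'rV[R]_d) (s : R) : 0 < s -> (forall k, 0 < r k) -> r @ \oo --> (0 : R) ->
  (\sum_(0 <= k <oo) (r k `^ s)%:E < +oo)%E -> hausdorff_measure s (covering_set r w) = 0%E.
Proof.
move=> s0 r0 rcvg rsum.
have dp0 (U : set 'rV[R]_d) : (0 <= diam_pow s U)%E.
  by rewrite /diam_pow; case: ifP => // _; exact: poweR_ge0.
have pre0 del (E : set 'rV[R]_d) : (0 <= hausdorff_premeasure s del E)%E.
  apply: le_ereal_inf_tmp => _ [U _ <-]; apply: nneseries_ge0 => i _ _; exact: dp0.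
have diam_ball k : (diam (eball (w k) (r k)) <= (2 * r k)%:E)%E.
  apply: ge_ereal_sup => _ [x [y [xk yk ->]]]; rewrite lee_fin.
  have := enorm_triangle x (w k) y; move: xk yk; rewrite /eball/= (enormB (w k) y).
  by lra.
have dpk k : (diam_pow s (eball (w k) (r k)) <= ((2 `^ s) * (r k `^ s))%:E)%E.
  rewrite /diam_pow; case: ifPn => _; first by rewrite lee_fin mulr_ge0 ?powR_ge0.
  rewrite -powRM ?(ltW (r0 k))//.
  have d0 : (0 <= diam (eball (w k) (r k)))%E.
    apply: le_trans (diam_enorm_le (eball_center (w k) (r0 k)) (eball_center (w k) (r0 k))).
    by rewrite lee_fin enorm_ge0.
  move: (diam_ball k) d0; case: (diam _) => [D| |]// ; rewrite !lee_fin => D1 D0.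
  by apply: ge0_ler_powR; rewrite ?nnegrE ?(ltW s0)// (le_trans D0).
apply/eqP; rewrite eq_le; apply/andP; split; last first.
  by apply: le_ereal_sup_tmp; exists (hausdorff_premeasure s 1 (covering_set r w)); [exists 1 =>
    //=|exact: pre0].
apply: ge_ereal_sup => _ [del /= del0 <-].
have tail_cvg : (\sum_(N <= k <oo) ((2 `^ s) * (r k `^ s))%:E @[N --> \oo] --> 0)%E.
  apply: nneseries_tail_cvg; last by move=> k _; rewrite lee_fin mulr_ge0 ?powR_ge0.
  under eq_eseriesr do rewrite EFinM.
  rewrite nneseriesZl; last by move=> k _; rewrite lee_fin powR_ge0.
  by rewrite lte_mul_pinfty// lee_fin powR_ge0.
apply: (cvge_ge _ tail_cvg).
(* A ball of radius less than [del / 2] has diameter at most [del]. *)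
have /cvgrPdist_lt/(_ (del / 2))[|N0 _ hN0] := rcvg; first by rewrite divr_gt0.
exists N0 => // N /= N0N.
apply: ge_ereal_inf; exists (\sum_(0 <= i <oo) diam_pow s (eball (w (i + N)%N) (r (i + N)%N)))%E.
  exists (fun i => eball (w (i + N)%N) (r (i + N)%N)) => //; split.
    move=> x /(_ N Logic.I)[k /= Nk xk]; exists (k - N)%N => //=.
    by rewrite subnK.
  move=> i; rewrite (le_trans (diam_ball _))// lee_fin.
  have := hN0 (i + N)%N (leq_trans N0N (leq_addl _ _)).
  by rewrite sub0r normrN gtr0_norm//; lra.
rewrite -(nneseries_addn N (f := fun k => (2 `^ s * r k `^ s)%:E)); last first.
  by move=> k; rewrite lee_fin mulr_ge0 ?powR_ge0.
by apply: lee_nneseries => i _; [move=> _; exact: dp0|exact: dpk].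
Qed.

Lemma hausdorff_dim_covering_le (R : realType) (d : nat) (r : nat -> R)
    (w : nat -> 'rV[R]_d) : (forall k, 0 < r k) -> r @ \oo --> (0 : R) ->
  (hausdorff_dim (covering_set r w) <= s2 r)%E.
Proof.
move=> r0 rcvg; apply: le_ereal_inf_tmp => _ [s [s0 rsum] <-].
apply: ereal_inf_lbound; exists s => //; split; first exact: ltW.
exact: hausdorff_measure_covering_set0.
Qed.

(** Bounds valid for every single limsup set, such as [hausdorff_dim_covering_le], transfer to [f]
    through one realization. *)
Lemma as_dim_witness (R : realType) (d : nat) (mu : probability (borelRd R d) R)
    (r : nat -> R) (P : probability (seqRd R d) R) (f : \bar R) :
  is_product_measure mu P -> is_as_dim mu P r f ->
  exists w : nat -> 'rV[R]_d, hausdorff_dim (covering_set r w) = f.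
Proof.
move=> P_prod f_as; apply: contrapT => /forallNP hw.
have : P.-negligible [set: seqRd R d].
  have [N1 [mN1 N10 hN1]] := ae_product_spt P_prod; have [N2 [mN2 N20 hN2]] := f_as.
  apply: (@negligibleS _ _ _ _ (N1 `|` N2)); last first.
    by apply: negligibleU; [exists N1; split|exists N2; split].
  move=> w _; apply: contrapT => /not_orP[nw1 nw2].
  have sw : forall k, spt mu ((w : nat -> 'rV[R]_d) k).
    by apply: contrapT => h; apply: nw1; exact: hN1.
  by apply: nw2; apply: hN2 => /= /(_ sw) hf; exact: hw hf.
move=> /(negligibleP _ measurableT) h.
have : (P [set: seqRd R d] = 1)%E by exact: probability_setT.
by rewrite h => /esym/eqP; rewrite onee_eq0.
Qed.

(** * Combination of the two bounds *)

Theorem theorem2p5 (R : realType) (d : nat)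
  (mu : probability (borelRd R d) R) (mu_compact : compact (spt mu))
  (r : nat -> R) (r_gt0 : forall k, 0 < r k) (r_cvg0 : r @ \oo --> (0 : R))
  (P : probability (seqRd R d) R) (P_prod : is_product_measure mu P)
  (f : \bar R) (f_as : is_as_dim mu P r f) :
  (s2 r < upper_dim_H mu)%E ->
  (s2 r * dim_loc_ratio mu (s2 r) <= f <= s2 r)%E.
Proof.
move=> s2lt; have [w fw] := as_dim_witness P_prod f_as.
apply/andP; split; last by rewrite -fw; exact: hausdorff_dim_covering_le.
have f0 : (0 <= f)%E by rewrite -fw; exact: hausdorff_dim_ge0.
have s2fin : s2 r \is a fin_num.
  by rewrite ge0_fin_numE ?s2_ge0// (lt_le_trans s2lt)// leey.
move: s2fin (s2_ge0 r) (@lt_s2_series _ r) => {s2lt}.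
(* For critical exponent 0 the left side is 0, even if the essential supremum is infinite. *)
case: (s2 r) => [S| |]// _; rewrite lee_fin le_eqVlt => /predU1P[<- _|S0 rS].
  by rewrite mul0e.
rewrite leNgt; apply/negP => fS.
have ffin : f \is a fin_num by rewrite ge0_fin_numE// (lt_le_trans fS)// leey.
rewrite -(fineK ffin) in f0 fS; move: (fineK ffin) f0 fS; set phi := fine f => phiE.
(* If the lower bound failed, some [u] would lie strictly between phi / S and the essential
   supremum. *)
rewrite lee_fin => phi0; rewrite muleC -lte_pdivrMr// => /ereal_rat_between[q].
move: (ratr q : R) => u phiu uratio.
have u0 : 0 < u by rewrite (le_lt_trans _ phiu)// divr_ge0// ltW.
have phiSu : phi / u < S by rewrite ltr_pdivrMr// mulrC -ltr_pdivrMr.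
(* A midpoint: s < S makes the series of the r_k^s diverge, while phi < s u keeps a gap above
   phi. *)
pose s := (phi / u + S) / 2.
have s0 : 0 < s by rewrite divr_gt0// ltr_wpDl// divr_ge0// ltW.
have sS : s < S by rewrite /s; lra.
have phis : phi < s * u by rewrite -ltr_pdivrMr// /s; lra.
have [a [b [A [Sa uba ab A0 F0]]]] := exists_regular_set (ltW S0) u0 uratio.
have a0 : 0 < a by exact: lt_trans Sa.
have b0 : 0 < b by exact: lt_trans ab.
pose F := closure (regular_set mu a b A : set 'rV[R]_d).
pose A' := A * 2 `^ a * 2 `^ b.
have A'0 : 0 < A' by rewrite !mulr_gt0 ?powR_gt0.
have FA : F `<=` regular_set mu a b A'.
  by apply: closure_regular_set; exact: ltW.
have cF : compact F.
  apply: (@subclosed_compact _ _ (spt mu)) => //; first exact: closed_closure.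
  by move=> x /FA; exact: regular_set_spt.
(* Strictly above phi, and below s u <= s a / b, so [as_dim_ge] contradicts f = phi. *)
pose t := (phi + s * u) / 2.
have tE : t < a * (s / b).
  apply: (@lt_le_trans _ _ (s * u)); first by rewrite /t; lra.
  by rewrite mulrCA ler_wpM2l ?(ltW s0)// ler_pdivlMr.
have : (t%:E <= f)%E.
  apply: (as_dim_ge r_gt0 r_cvg0 P_prod f_as cF F0 A'0 (ltW a0) _ _ s0 _ tE) => //.
  - by move=> x /FA[].
  - by move=> x /FA[].
  - by rewrite ltW// (lt_trans sS)// (lt_trans Sa).
  - exact: rS.
by rewrite -phiE lee_fin leNgt => /negP; apply; rewrite /t; lra.
Qed.
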